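(* Let $\Gamma$ be a countable group, $(X,\mu)$ a standard probability space and $\Gamma\curvearrowright X$ an ergodic probability measure preserving action that is not strongly ergodic. Then the equivalence relation $\sim$ on $\mathrm{Hom}(\mathcal{R}(\Gamma\curvearrowright X),E_0)$ is not classifiable by countable structures.
   Context: $\mathcal{R}(\Gamma\curvearrowright X)$ is the orbit equivalence relation of the action. $E_0$ is the equivalence relation on $\{0,1\}^{\mathbb{N}}$ given by $\mathbf{x}E_0\mathbf{y}$ iff there is $N\in\mathbb{N}$ with $x_n=y_n$ for all $n\ge N$. A homomorphism from an equivalence relation $E$ on $X$ to $F$ on $Y$ is a Borel map $f:X\to Y$ with $xEy\Rightarrow f(x)Ff(y)$; Borel functions are identified when they agree $\mu$-almost everywhere (so the homomorphism property is required on a conull set). $\mathrm{Hom}(E,F)$ is the space of homomorphisms, a standard Borel space with the $\sigma$-algebra inherited from the space $B(X,Y)$ of Borel maps, generated by the functions $f\mapsto\mu(A\cap f^{-1}(B))$, $A\subseteq X$, $B\subseteq Y$ Borel. For $\varphi,\psi\in\mathrm{Hom}(\mathcal{R}(\Gamma\curvearrowright X),E_0)$, $\varphi\sim\psi$ iff $\varphi(x)E_0\psi(x)$ for almost every $x$. A sequence of measurable sets $(A_n)$ is almost invariant if $\lim_n\mu(A_n\Delta gA_n)=0$ for all $g\in\Gamma$; it is trivial if $\lim_n\mu(A_n)(1-\mu(A_n))=0$. An ergodic pmp action is strongly ergodic if every almost invariant sequence is trivial. For equivalence relations $E$ on $Y$ and $F$ on $Z$ (standard Borel spaces), $E\le_B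 F$ means there is a Borel map $f:Y\to Z$ with $xEy\iff f(x)Ff(y)$. A countable signature $L$ is a countable family of function symbols $f_i$ (arity $n_i\ge0$) and relation symbols $R_j$ (arity $m_j\ge1$); $X_L=\prod_i\mathbb{N}^{(\mathbb{N}^{n_i})}\times\prod_j2^{(\mathbb{N}^{m_j})}$ is the Polish space of $L$-structures with universe $\mathbb{N}$, and $\cong_L$ is isomorphism on $X_L$. $E$ is classifiable by countable structures if $E\le_B(\cong_L)$ for some countable signature $L$. *)

(* Defs.v *)
From HB Require Import structures.
From mathcomp Require Import all_boot all_order all_algebra.
From mathcomp Require Import all_classical all_reals all_analysis.
From mathcomp Require Import measurable_realfun.

Set Implicit Arguments.
Unset Strict Implicit.
Unset Printing Implicit Defensive.

Import Order.TTheory GRing.Theory Num.Theory.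
Import numFieldNormedType.Exports.

Local Open Scope classical_set_scope.

Definition borel (T : ptopologicalType) := g_sigma_algebraType (@open T).

Definition polish (R : realType) (P : completePseudoMetricType R) : Prop :=
  hausdorff_space P /\ exists2 D : set P, countable D & dense D.

Definition standard_borel (R : realType) (d : measure_display)
    (T : measurableType d) : Prop :=
  exists (P : completePseudoMetricType R) (f : T -> P),
    [/\ polish P, bijective f &
        forall A : set T, measurable A <-> <<s @open P >> (f @` A)].

Definition borel_reducible (d1 d2 : measure_display) (Y : measurableType d1)
    (Z : measurableType d2) (E : Y -> Y -> Prop) (F : Z -> Z -> Prop) : Prop :=
  exists2 f : Y -> Z, measurable_fun setT f &
    forall x y, E x y <-> F (f x) (f y).

Record signature := Signature {
  fsym : countType;
  farity : fsym -> nat;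
  rsym : countType;
  rarity : rsym -> nat;
  rarity_gt0 : forall j, (0 < rarity j)%N }.

Definition countable_structure (L : signature) : Type :=
  prod_topology (fun i : fsym L => {ptws (farity i).-tuple nat -> nat}) *
  prod_topology (fun j : rsym L => {ptws (rarity j).-tuple nat -> bool}).

HB.instance Definition _ (L : signature) :=
  Topological.on (countable_structure L).
HB.instance Definition _ (L : signature) :=
  Pointed.on (countable_structure L).

Definition structure_iso (L : signature) (M N : countable_structure L) : Prop :=
  exists g : nat -> nat,
    [/\ bijective g,
        forall (i : fsym L) (t : (farity i).-tuple nat),
          g (M.1 i t) = N.1 i [tuple of map g t] &
        forall (j : rsym L) (t : (rarity j).-tuple nat),
          M.2 j t = N.2 j [tuple of map g t]].

Definition classifiable_by_countable_structures (d : measure_display)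
    (Y : measurableType d) (E : Y -> Y -> Prop) : Prop :=
  exists L : signature,
    borel_reducible E (@structure_iso L : borel (countable_structure L) -> _ -> _).

Record pmp_action (G : groupType) (R : realType) (d : measure_display)
    (X : measurableType d) (mu : probability X R) := PmpAction {
  act :> G -> X -> X;
  act1 : forall x, act 1%g x = x;
  actM : forall g h x, act (g * h)%g x = act g (act h x);
  measurable_act : forall g, measurable_fun setT (act g);
  measure_act : forall g A, measurable A -> mu (act g @^-1` A) = mu A }.

Section Actions.
Context (G : groupType) (R : realType) (d : measure_display)
  (X : measurableType d) (mu : probability X R) (a : pmp_action G mu).

Definition orbit_rel (x y : X) : Prop := exists g, a g x = y.

Definition ergodic : Prop :=
  forall A, measurable A -> (forall g, a g @` A = A) ->
    mu A = 0%E \/ mu A = 1%E.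

Definition almost_invariant (A : (set X)^nat) : Prop :=
  (forall n, measurable (A n)) /\
  forall g, mu (A n `+` a g @` A n) @[n --> \oo] --> 0%E.

Definition trivial_sequence (A : (set X)^nat) : Prop :=
  (mu (A n) * (1 - mu (A n)))%E @[n --> \oo] --> 0%E.

Definition strongly_ergodic : Prop :=
  ergodic /\ forall A, almost_invariant A -> trivial_sequence A.

End Actions.

(* The representative chosen by [{mfun_ mu, X >-> Y}] is immaterial in the
   definitions below, since they are all insensitive to null sets. *)
Section BorelMaps.
Context (R : realType) (d1 d2 : measure_display) (X : measurableType d1)
  (Y : measurableType d2) (mu : probability X R).

Definition borel_map_generators : set_system {mfun_ mu, X >-> Y} :=
  [set W | exists (A : set X) (B : set Y), [/\ measurable A, measurable B &
     preimage_set_system setT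
       (fun f : {mfun_ mu, X >-> Y} => mu (A `&` f @^-1` B)) measurable W]].

HB.instance Definition _ := isPointed.Build {mfun_ mu, X >-> Y}
  (\pi_({mfun_ mu, X >-> Y})%qT (cst point : {mfun X >-> Y})).

Definition borel_maps := g_sigma_algebraType borel_map_generators.

Definition hom_set (E : X -> X -> Prop) (F : Y -> Y -> Prop) :
    set {mfun_ mu, X >-> Y} :=
  [set f | exists2 X0 : set X, mu.-negligible (~` X0) &
     forall x y, X0 x -> X0 y -> E x y -> F (f x) (f y)].

Definition hom (E : X -> X -> Prop) (F : Y -> Y -> Prop) : Type :=
  hom_set E F.

Definition hom_equiv (E : X -> X -> Prop) (F : Y -> Y -> Prop)
    (phi psi : hom E F) : Prop :=
  {ae mu, forall x, F (val phi x) (val psi x)}.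
End BorelMaps.

Definition E0 (x y : borel cantor_space) : Prop :=
  exists N : nat, forall n, (N <= n)%N -> x n = y n.

Section HomE0.
Context (R : realType) (d : measure_display) (X : measurableType d)
  (mu : probability X R) (E : X -> X -> Prop).

Definition hom_E0 : Type := hom mu E E0.

(* The class of a constant map: a [measurableType] has to be inhabited. *)
Lemma hom_set_point : hom_set E E0 (point : {mfun_ mu, X >-> borel cantor_space}).
Proof.
set f : {mfun_ mu, X >-> borel cantor_space} := point.
have ae_f : {ae mu, forall x, f x = point}.
  have /asboolP : ae_eq_op mu (repr f) (cst point).
    by apply/eqmodP; rewrite reprK.
  by apply: filterS => x; exact.
exists [set x | f x = point] => // x y /= -> -> _.
by exists 0%N.
Qed.

HB.instance Definition _ := Choice.on hom_E0.
HB.instance Definition _ := isPointed.Build hom_E0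
  (SigSub (mem_set hom_set_point)).

Definition hom_E0_borel := g_sigma_algebra_preimageType
  (fun f : hom_E0 => val f : borel_maps (borel cantor_space) mu).
End HomE0.

(* Main.v *)
Require Import Defs.
From mathcomp Require Import all_boot all_order all_algebra.
From mathcomp Require Import all_classical all_reals all_analysis.
From mathcomp Require Import zify ring lra.

Set Implicit Arguments.
Unset Strict Implicit.
Unset Printing Implicit Defensive.

Import Order.TTheory GRing.Theory Num.Theory.
Import numFieldNormedType.Exports.

Local Open Scope classical_set_scope.
Local Open Scope ring_scope.

(** The equivalence of homomorphisms contains a turbulent relation on [nat -> nat].

    _Construction._ Failure of strong ergodicity gives an almost invariant
    sequence [A n] with measures bounded away from 0 and 1.  Ergodicity forces
    such sets to cut every set of positive measure nontrivially, so the finite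
    partitions generated by [A 0, ..., A (k-1)] have mesh tending to 0
    ([itinerary_thin]).  Adding the atoms of such a partition one after the other
    yields, for each [n], a path [B n 0 = set0, B n 1, ..., B n (M n) = setT] of
    sets that are invariant up to [2 ^- n.+1] under the first [n] group elements
    and whose consecutive differences have measure at most [2 ^- n.+1]
    ([invariant_chain]).  To [x : nat -> nat] is attached the map
    [chain_code x : w |-> (n |-> w \in B n (x n))].  By Borel-Cantelli it is a
    homomorphism to [E0], and its class does not change when every coordinate of
    [x] is moved by at most one; but if [x n = 0] and [M n <= y n] for infinitely
    many [n], then [chain_code x w] and [chain_code y w] are never
    [E0]-equivalent.

    _Generic ergodicity._ Suppose that the class of [chain_code x] were
    determined by the isomorphism type of a countable structure [F x] depending
    measurably on [x].  Then [F x] is invariant under moving all coordinates by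
    at most one.  The moves split into two actions of the compact group
    [nat -> bool], and composing them one can walk from any point of a cylinder
    to any other while staying in the cylinder: this is turbulence.  Hjorth's
    argument then shows that [F x] has the same isomorphism type for all generic
    [x] ([generic_isomorphism]).  For fixed [m], on a small enough cylinder a
    generic move changes [F x] by an isomorphism that fixes [0, ..., m-1], because
    there are only countably many ways to map [m] points to [F x]
    ([stable_cylinder_cofinal]).  Walking inside the cylinder, two generic points
    [x] and [y] of it can be replaced by equivalent ones that are as close as
    desired without disturbing the first [m] points of either structure, and this
    is what a back-and-forth construction between [F x] and [F y] needs.

    Generic [x] and [y] satisfy [x n = 0] and [M n <= y n] infinitely often, so
    the two parts contradict each other. *)

(** * Cylinders and Baire category for sequences in a countable set *)

Section Cylinders.
Variable T : eqType.
Implicit Types (u v : seq T) (x y : nat -> T).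

Definition cyl u : set (nat -> T) := [set x | mkseq x (size u) = u].

Lemma cyl_mkseq x n : cyl (mkseq x n) x.
Proof. by rewrite /cyl /= size_mkseq. Qed.

Lemma prefix_mkseq x m n : (m <= n)%N -> prefix (mkseq x m) (mkseq x n).
Proof.
move=> lemn; apply/prefixP; exists (map x (iota m (n - m))).
by rewrite /mkseq -map_cat -{2}[m]add0n -iotaD subnKC.
Qed.

Lemma prefix_cyl u v x : prefix u v -> cyl v x -> cyl u x.
Proof.
move=> /prefixP[w ->]; rewrite /cyl /= size_cat => e.
have := prefix_mkseq x (leq_addr (size w) (size u)).
rewrite e => /prefixP[w' /eqP]; rewrite eqseq_cat ?size_mkseq//.
by move=> /andP[/eqP<-].
Qed.

Lemma cyl_prefix_mkseq u x n : cyl u x -> (size u <= n)%N -> prefix u (mkseq x n).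
Proof. by move=> {2}<- un; exact: prefix_mkseq. Qed.

Lemma cyl_mkseq_agree x y n :
  cyl (mkseq x n) y <-> forall i, (i < n)%N -> y i = x i.
Proof.
rewrite /cyl /= size_mkseq; split=> [e i ltin|e].
  by rewrite -(nth_mkseq (y i) y ltin) e nth_mkseq.
by apply/eq_in_map => i; rewrite mem_iota => /e.
Qed.

Lemma cyl_agree u x y : (forall i, (i < size u)%N -> y i = x i) ->
  cyl u x -> cyl u y.
Proof.
move=> yx; rewrite /cyl /= => {2}<-; apply/eq_in_map => i.
by rewrite mem_iota => /yx.
Qed.

Lemma cyl_nth (d : T) u x :
  cyl u x <-> forall i, (i < size u)%N -> x i = nth d u i.
Proof.
rewrite -{1}(mkseq_nth d u); exact: cyl_mkseq_agree.
Qed.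

Lemma cyl_inter u v x : cyl u x -> cyl v x -> prefix u v \/ prefix v u.
Proof.
move=> ux vx; have [uv|/ltnW vu] := leqP (size u) (size v).
  by left; rewrite -vx; exact: cyl_prefix_mkseq.
by right; rewrite -ux; exact: cyl_prefix_mkseq.
Qed.
End Cylinders.

Section Comeager.
Variable T : countType.
Implicit Types (u v : seq T) (x y : nat -> T) (A B : set (nat -> T)).

Definition cofinal (D : set (seq T)) := forall u, exists2 v, prefix u v & D v.

(** A cofinal family of finite sequences generates a dense open set of the product
    of discrete spaces, and each dense open set arises so; countable families of
    them therefore present the comeager sets without mentioning a topology. *)
Definition comeager A := exists2 D : nat -> set (seq T),
  forall k, cofinal (D k) &
  forall x, (forall k, exists n, D k (mkseq x n)) -> A x.

Definition comeager_in u A := comeager [set x | cyl u x -> A x].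

Lemma sub_comeager A B : A `<=` B -> comeager A -> comeager B.
Proof. by move=> AB [D cD DA]; exists D => // x /DA /AB. Qed.

Lemma comeager_in_sub u A B :
  (forall x, cyl u x -> A x -> B x) -> comeager_in u A -> comeager_in u B.
Proof. by move=> AB; apply: sub_comeager => x Ax ux; exact: AB (Ax ux). Qed.

Lemma comeager_meets (D : set (seq T)) : cofinal D ->
  comeager [set x | exists n, D (mkseq x n)].
Proof. by move=> cD; exists (fun=> D) => // x /(_ 0%N). Qed.

Lemma comeager_setT A : (forall x, A x) -> comeager A.
Proof. by move=> AT; exists (fun=> setT) => // k u; exists u; rewrite ?prefix_refl. Qed.

Lemma comeager_bigcap (I : countType) (A : I -> set (nat -> T)) :
  (forall i, comeager (A i)) -> comeager [set x | forall i, A i x].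
Proof.
move=> cA.
have /choice[D DA] i : exists D : nat -> set (seq T),
    (forall k, cofinal (D k)) /\
    forall x, (forall k, exists n, D k (mkseq x n)) -> A i x.
  by have [D ? ?] := cA i; exists D.
exists (fun n => if @unpickle (I * nat)%type n is Some (i, k)
    then D i k else setT).
  move=> k; case: unpickle => [[i n]|]; first exact: ((DA i).1 n).
  by move=> u; exists u; rewrite ?prefix_refl.
move=> x Dx i; apply: (DA i).2 => k.
by have := Dx (pickle (i, k)); rewrite pickleK.
Qed.

Lemma comeagerI A B : comeager A -> comeager B -> comeager (A `&` B).
Proof.
move=> cA cB; apply: sub_comeager (_ : comeager [set x | forall b : bool,
  (if b then A else B) x]); last by apply: comeager_bigcap => -[].
by move=> x AB; split; [exact: AB true|exact: AB false].
Qed.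

Lemma comeager_comeager_in u A : comeager A -> comeager_in u A.
Proof. by apply: sub_comeager => x Ax _. Qed.

(** Baire category theorem: extend [u] step by step so as to enter each of the
    dense open sets. *)
Lemma baire (t0 : T) u A : comeager_in u A -> exists2 x, cyl u x & A x.
Proof.
move=> [D cD DA].
have /choice[nxt nxtP] (p : nat * seq T) : exists v,
    [/\ prefix p.2 v, (size p.2 < size v)%N &
        exists2 w, prefix w v & D p.1 w].
  (* one more entry makes the lengths grow, so that the limit is everywhere
     defined *)
  have [w uw Dw] := cD p.1 p.2; exists (rcons w t0); split.
  - by apply: prefix_trans uw _; exact: prefix_rcons.
  - by rewrite size_rcons ltnS (size_prefix uw).
  - by exists w => //; exact: prefix_rcons.
pose s := fix s n := if n is n'.+1 then nxt (n', s n') else u.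
have sS n : prefix (s n) (s n.+1) by have [] := nxtP (n, s n).
have smono m n : (m <= n)%N -> prefix (s m) (s n).
  move=> /subnKC<-; elim: (n - m)%N => [|k IH]; first by rewrite addn0 prefix_refl.
  by rewrite addnS; exact: prefix_trans IH (sS _).
have ssz n : (n <= size (s n))%N.
  by elim: n => // n IH; apply: leq_ltn_trans IH _; have [] := nxtP (n, s n).
pose x n := nth t0 (s n.+1) n.
have nths m n i : (i < size (s m))%N -> (m <= n)%N ->
    nth t0 (s n) i = nth t0 (s m) i.
  by move=> im /smono/prefixP[w ->]; rewrite nth_cat im.
have cylx n : cyl (s n) x.
  rewrite /cyl /=; apply: (@eq_from_nth _ t0); rewrite size_mkseq// => i isn.
  rewrite nth_mkseq// /x; have [lein|ltni] := leqP i.+1 n.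
    by rewrite (nths i.+1 n)//; exact: ssz.
  by rewrite (nths n i.+1)//; exact: ltnW.
exists x; first exact: (cylx 0%N).
apply: DA (cylx 0%N) => k; have [_ _ [w wv Dw]] := nxtP (k, s k).
exists (size w); suff -> : mkseq x (size w) = w by [].
exact: (prefix_cyl wv (cylx k.+1)).
Qed.

(** A generic point enters a cylinder in which [A] is comeager, and there are only
    countably many such cylinders to take into account. *)
Lemma comeager_local A :
  (forall u, exists2 v, prefix u v & comeager_in v A) -> comeager A.
Proof.
move=> loc; have cE : cofinal [set v | comeager_in v A] by [].
apply: sub_comeager (comeagerI (comeager_meets cE) (_ : comeager
  [set x | forall v, comeager_in v A -> cyl v x -> A x])).
  by move=> x [[n An] Ax]; apply: (Ax _ An); exact: cyl_mkseq.
apply: comeager_bigcap => v; have [cv|ncv] := pselect (comeager_in v A).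
  by apply: sub_comeager cv => x.
by apply: comeager_setT.
Qed.

Lemma comeager_in_local u A :
  (forall v, prefix u v -> exists2 w, prefix v w & comeager_in w A) ->
  comeager_in u A.
Proof.
move=> loc; apply: comeager_local => v.
have [uv|nuv] := boolP (prefix u v).
  have [w vw cw] := loc v uv; exists w => //.
  by apply: comeager_in_sub cw => x wx Ax _.
have [vu|nvu] := boolP (prefix v u).
  have [w uw cw] := loc u (prefix_refl u).
  exists w; first exact: prefix_trans vu uw.
  by apply: comeager_in_sub cw => x wx Ax _.
exists v; first exact: prefix_refl.
apply: comeager_setT => x vx ux.
by have [] := cyl_inter ux vx; rewrite ?(negPf nuv) ?(negPf nvu).
Qed.

Lemma comeager_often (t0 : T) (P : nat -> T -> Prop) :
  (forall N, exists n, (N <= n)%N /\ exists t, P n t) ->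
  comeager [set x | forall N, exists n, (N <= n)%N /\ P n (x n)].
Proof.
move=> exP; apply: comeager_bigcap => N.
have cof : cofinal [set u : seq T |
    exists n, [/\ (N <= n)%N, (n < size u)%N & P n (nth t0 u n)]].
  move=> u; have [n [Nun [t Pt]]] := exP (N + size u)%N.
  have un : (size u <= n)%N := leq_trans (leq_addl _ _) Nun.
  exists (rcons (u ++ nseq (n - size u) t0) t).
    exact: prefix_trans (prefix_prefix u _) (prefix_rcons _ _).
  have sz : size (u ++ nseq (n - size u) t0) = n.
    by rewrite size_cat size_nseq subnKC.
  exists n; split; first exact: leq_trans (leq_addr _ _) Nun.
    by rewrite size_rcons sz.
  by rewrite nth_rcons sz ltnn eqxx.
apply: sub_comeager (comeager_meets cof) => x [k [n [Nn nk Pn]]].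
exists n; split=> //; rewrite size_mkseq in nk.
by rewrite nth_mkseq// in Pn.
Qed.

(** For a set that is open modulo a meager set, both it and its complement are
    open modulo meager sets, so densely many cylinders decide it.  This local form
    of the property of Baire makes the closure under countable unions short. *)
Definition baire_property A := forall u, exists2 v, prefix u v &
  comeager_in v A \/ comeager_in v (~` A).

Lemma baire_property_setC A : baire_property A -> baire_property (~` A).
Proof.
move=> bA u; have [v uv [|]] := bA u => cv; exists v => //; last by left.
by right; rewrite setCK.
Qed.

Lemma baire_property_bigcup (A : nat -> set (nat -> T)) :
  (forall i, baire_property (A i)) -> baire_property (\bigcup_i A i).
Proof.
move=> bA u.
have [[v uv [i ci]]|H] := pselect (exists2 v, prefix u v &
    exists i, comeager_in v (A i)).
  by exists v => //; left; apply: comeager_in_sub ci => x _ Aix; exists i.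
(* no [A i] is comeager in any cylinder below u, so all are meager in u *)
exists u; [exact: prefix_refl|right].
have cA i : comeager_in u (~` A i).
  apply: comeager_in_local => v uv; have [w vw [cw|cw]] := bA i v; last by exists w.
  by exfalso; apply: H; exists w; [exact: prefix_trans vw|exists i].
apply: sub_comeager (comeager_bigcap cA) => x Ax ux [i _].
exact: Ax.
Qed.

(** The classical fact that Borel functions are continuous on a comeager set: [C]
    consists of the points that, for each [i], lie in a cylinder deciding [A i]
    and obey every decision about [A i] made by a cylinder around them. *)
Lemma baire_property_continuous (I : countType) (A : I -> set (nat -> T)) :
  (forall i, baire_property (A i)) ->
  exists2 C, comeager C & forall x i, C x ->
    exists n, forall y, C y -> cyl (mkseq x n) y -> (A i y <-> A i x).
Proof.
move=> bA.
exists [set x | forall i, (exists n, comeager_in (mkseq x n) (A i) \/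
      comeager_in (mkseq x n) (~` A i)) /\
    forall v, (comeager_in v (A i) -> cyl v x -> A i x) /\
      (comeager_in v (~` A i) -> cyl v x -> ~ A i x)].
  apply: comeager_bigcap => i; apply: comeagerI; first exact: comeager_meets (bA i).
  have imp v B : comeager [set x | comeager_in v B -> cyl v x -> B x].
    have [cv|ncv] := pselect (comeager_in v B).
      by apply: sub_comeager cv => x Bx _.
    by apply: comeager_setT => x /ncv.
  apply: comeager_bigcap => v; exact: comeagerI (imp v (A i)) (imp v (~` A i)).
move=> x i /(_ i)[[n cn] Ax]; exists n => y /(_ i)[_ Ay] xy.
have xx := cyl_mkseq x n.
by case: cn => cn; [have := (Ax _).1 cn xx; have := (Ay _).1 cn xy
  |have := (Ax _).2 cn xx; have := (Ay _).2 cn xy].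
Qed.

Definition everywhere_nonmeager A u :=
  forall v, prefix u v -> ~ comeager_in v (~` A).

Lemma nonmeager_everywhere u A : ~ comeager_in u (~` A) ->
  exists2 v, prefix u v & everywhere_nonmeager A v.
Proof.
move=> ncA; apply: contrapT => H; apply: ncA; apply: comeager_in_local => v uv.
apply: contrapT => Hv; apply: H; exists v => // w vw cw.
by apply: Hv; exists w.
Qed.

Lemma nonmeager_bigcup (I : countType) (A : I -> set (nat -> T)) B u :
  B `<=` \bigcup_i A i -> ~ comeager_in u (~` B) ->
  exists i, ~ comeager_in u (~` A i).
Proof.
move=> BA ncB; apply: contrapT => H; apply: ncB.
have cA i : comeager_in u (~` A i) by apply: contrapT => Hi; apply: H; exists i.
apply: sub_comeager (comeager_bigcap cA) => x Ax ux /BA[i _].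
exact: Ax.
Qed.

Lemma nonmeager_meets (t0 : T) u A B : comeager B -> ~ comeager_in u (~` A) ->
  exists x, [/\ cyl u x, A x & B x].
Proof.
move=> cB ncA; apply: contrapT => H; apply: ncA.
apply: sub_comeager cB => x Bx ux Ax; apply: H; by exists x.
Qed.

(** What is needed of the theorem that analytic sets have the property of Baire.
    For a finite sequence [a], let [A a] be the set of [z] having a witness that
    begins with [a].  If [A a] is everywhere nonmeager in a cylinder, then below
    it some [A (rcons a k)] is so on a smaller one.  A generic [z] hence follows a
    branch [w] all of whose initial segments [a] have [A a] nonmeager near [z];
    as [P] is closed on [Z], the limit [w] is a witness for [z]. *)
Lemma analytic_comeager (t0 : T) (W : countType) (w0 : W) (Z : set (nat -> T))
    (P : (nat -> T) -> (nat -> W) -> Prop) u :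
  comeager Z ->
  (forall z w, Z z -> (forall n, exists z' w',
     [/\ Z z', cyl (mkseq z n) z', cyl (mkseq w n) w' & P z' w']) -> P z w) ->
  ~ comeager_in u (~` [set z | exists w, P z w]) ->
  exists2 v, prefix u v & comeager_in v [set z | exists w, P z w].
Proof.
move=> cZ Pcl /nonmeager_everywhere[v uv nmv]; exists v => //.
pose A (a : seq W) := [set z | exists2 w, cyl a w & P z w].
have cG : comeager [set z | forall a s, everywhere_nonmeager (A a) s -> cyl s z ->
    exists k n, (size s <= n)%N /\ everywhere_nonmeager (A (rcons a k)) (mkseq z n)].
  apply: comeager_bigcap => a; apply: comeager_bigcap => s.
  have [nms|] := pselect (everywhere_nonmeager (A a) s); last first.
    by move=> ?; exact: comeager_setT.
  suff : comeager_in s [set z | exists k n,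
      (size s <= n)%N /\ everywhere_nonmeager (A (rcons a k)) (mkseq z n)].
    by apply: sub_comeager => z.
  apply: comeager_in_local => s1 ss1.
  have [||k /nonmeager_everywhere[s2 s12 nm2]] :=
    @nonmeager_bigcup W (fun k => A (rcons a k)) (A a) s1.
  - move=> z [w aw Pzw]; exists (w (size a)) => //; exists w => //.
    by rewrite /cyl /= size_rcons mkseqS aw.
  - exact: nms.
  exists s2 => //; apply: comeager_setT => z s2z.
  exists k, (size s2); split; last by rewrite s2z.
  exact: leq_trans (size_prefix ss1) (size_prefix s12).
apply: sub_comeager (comeagerI cZ cG) => z [Zz Gz] vz.
have nm0 : everywhere_nonmeager (A [::]) v.
  move=> v1 vv1 cv1; apply: (nmv v1 vv1); apply: comeager_in_sub cv1.
  by move=> y _ nA [w Pyw]; apply: nA; exists w.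
have evS a s t : prefix s t -> everywhere_nonmeager a s -> everywhere_nonmeager a t.
  by move=> st nm t' tt'; apply: nm; exact: prefix_trans st tt'.
have /choice[nxt nxtP] (p : seq W * nat) : exists q : W * nat,
    everywhere_nonmeager (A p.1) (mkseq z p.2) ->
    (p.2 < q.2)%N /\ everywhere_nonmeager (A (rcons p.1 q.1)) (mkseq z q.2).
  have [nm|] := pselect (everywhere_nonmeager (A p.1) (mkseq z p.2)); last first.
    by exists (w0, 0%N).
  have [k [n [_ nmn]]] := Gz _ _ nm (cyl_mkseq _ _).
  exists (k, maxn n p.2.+1) => _ /=; split; first exact: leq_maxr.
  exact: evS (prefix_mkseq _ (leq_maxl _ _)) nmn.
pose q := fix q n := if n is n'.+1
  then (rcons (q n').1 (nxt (q n')).1, (nxt (q n')).2) else ([::], size v).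
have qnm n : everywhere_nonmeager (A (q n).1) (mkseq z (q n).2).
  elim: n => [|n IH] /=; first by rewrite vz.
  by have [] := nxtP _ IH.
have qn n : (n <= (q n).2)%N.
  elim: n => //= n IH; apply: leq_ltn_trans IH _.
  by have [] := nxtP _ (qnm n).
pose w n := (nxt (q n)).1.
have qw n : (q n).1 = mkseq w n.
  by elim: n => //= n ->; rewrite mkseqS.
exists w; apply: Pcl Zz _ => n.
have nmn : ~ comeager_in (mkseq z (q n).2) (~` A (q n).1).
  exact: qnm (prefix_refl _).
have [z' [zz' [w' ww' Pz'w'] Zz']] := nonmeager_meets t0 cZ nmn.
exists z', w'; split => //; last by rewrite -qw.
exact: prefix_cyl (prefix_mkseq z (qn n)) zz'.
Qed.
End Comeager.

Section Coordinatewise.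
Variables (S T : countType) (s0 : S) (phi : nat -> S -> T).

(** Coordinatewise surjections are open and continuous.  This covers coordinate
    projections as well as the translations by an element of a group acting
    coordinatewise. *)
Lemma comeager_preimage (A : set (nat -> T)) :
  (forall n t, exists s, phi n s = t) ->
  comeager A -> comeager [set x | A (fun n => phi n (x n))].
Proof.
move=> phiS.
have /choice[psi psiK] n : exists psi, forall t, phi n (psi t) = t.
  by have /choice[psi psiK] := phiS n; exists psi.
move=> [D cD DA].
exists (fun k => [set u | forall x, cyl u x ->
    D k (mkseq (fun n => phi n (x n)) (size u))]); last first.
  move=> x Dx; apply: DA => k; have [n /(_ x (cyl_mkseq x n))] := Dx k.
  by rewrite size_mkseq; exists n.
move=> k u; pose x0 := nth s0 u.
have [v uv Dv] := cD k (mkseq (fun n => phi n (x0 n)) (size u)).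
pose x1 n := if (n < size u)%N then x0 n else psi n (nth (phi 0%N s0) v n).
have x1v : mkseq (fun n => phi n (x1 n)) (size v) = v.
  apply: (@eq_from_nth _ (phi 0%N s0)); rewrite size_mkseq// => i iv.
  rewrite nth_mkseq// /x1; case: ifPn => // iu.
  by move/prefixP: uv => [w ->]; rewrite nth_cat size_mkseq iu nth_mkseq.
exists (mkseq x1 (size v)).
  apply: cyl_prefix_mkseq; last by have := size_prefix uv; rewrite size_mkseq.
  apply: (@cyl_agree _ _ x0) => [i iu|]; first by rewrite /x1 iu.
  by rewrite /cyl /= mkseq_nth.
move=> x; rewrite size_mkseq => xv; rewrite -x1v in Dv.
suff -> : mkseq (fun n => phi n (x n)) (size v) = mkseq (fun n => phi n (x1 n)) (size v).
  by [].
have agr := (cyl_mkseq_agree x1 x (size v)).1 xv.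
by apply/eq_in_map => i; rewrite mem_iota => /agr ->.
Qed.
End Coordinatewise.

(** The half of the Kuratowski-Ulam theorem that holds without measurability. *)
(** The half of the Kuratowski-Ulam theorem that concerns comeager sets: for a
    given dense open set and a given [u], it is an open dense condition on [y] to
    enter the dense open set above some extension of [u]. *)
Lemma kuratowski_ulam (S T : countType) (s0 : S) (t0 : T) (A : set (nat -> S * T)) :
  comeager A ->
  comeager [set y : nat -> T | comeager [set x : nat -> S | A (fun n => (x n, y n))]].
Proof.
move=> [D cD DA].
pose pair (x : nat -> S) (y : nat -> T) n := (x n, y n).
apply: sub_comeager (_ : comeager [set y : nat -> T | forall k (u : seq S), exists n,
   exists2 v, prefix u v & size v = n /\ forall x, cyl v x -> D k (mkseq (pair x y) n)]).
  move=> y Hy; exists (fun k => [set v : seq S | forall x, cyl v x ->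
      D k (mkseq (pair x y) (size v))]).
    by move=> k u; have [n [v uv [<- Dv]]] := Hy k u; exists v.
  move=> x Dx; apply: DA => k; have [n /(_ x (cyl_mkseq x n))] := Dx k.
  by rewrite size_mkseq; exists n.
apply: comeager_bigcap => k; apply: comeager_bigcap => u.
apply: sub_comeager (@comeager_meets _ [set t : seq T |
   exists2 v, prefix u v & size v = size t /\
     forall x y, cyl v x -> cyl t y -> D k (mkseq (pair x y) (size t))] _).
  move=> y [n [v uv [vt Dv]]]; move: vt Dv; rewrite size_mkseq => vt Dv.
  by exists n, v => //; split=> // x vx; apply: Dv => //; exact: cyl_mkseq.
move=> t; pose n := maxn (size u) (size t).
have [w nw Dw] := cD k (mkseq (pair (nth s0 u) (nth t0 t)) n).
have wn : (n <= size w)%N by have := size_prefix nw; rewrite size_mkseq.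
pose x1 i := (nth (s0, t0) w i).1; pose y1 i := (nth (s0, t0) w i).2.
have w1 i : (i < n)%N -> x1 i = nth s0 u i /\ y1 i = nth t0 t i.
  move=> iln; rewrite /x1 /y1; move/prefixP: nw => [w' ->].
  by rewrite nth_cat size_mkseq iln nth_mkseq.
have ww : w = mkseq (pair x1 y1) (size w).
  apply: (@eq_from_nth _ (s0, t0)); rewrite ?size_mkseq// => i iw.
  by rewrite nth_mkseq// /pair /x1 /y1; case: nth.
exists (mkseq y1 (size w)).
  apply: cyl_prefix_mkseq; last exact: leq_trans (leq_maxr _ _) wn.
  apply: (@cyl_agree _ _ (nth t0 t)); last by rewrite /cyl /= mkseq_nth.
  by move=> i it; apply: (w1 i _).2; exact: leq_trans it (leq_maxr _ _).
exists (mkseq x1 (size w)).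
  apply: cyl_prefix_mkseq; last exact: leq_trans (leq_maxl _ _) wn.
  apply: (@cyl_agree _ _ (nth s0 u)); last by rewrite /cyl /= mkseq_nth.
  by move=> i iu; apply: (w1 i _).1; exact: leq_trans iu (leq_maxl _ _).
rewrite !size_mkseq; split => // x y /cyl_mkseq_agree xx /cyl_mkseq_agree yy.
suff -> : mkseq (pair x y) (size w) = w by [].
by rewrite [RHS]ww; apply/eq_in_map => i; rewrite mem_iota /pair => /= iw; rewrite xx ?yy.
Qed.

Lemma kuratowski_ulam_swap (S T : countType) (s0 : S) (t0 : T) (A : set (nat -> S * T)) :
  comeager A ->
  comeager [set x : nat -> S | comeager [set y : nat -> T | A (fun n => (x n, y n))]].
Proof.
move=> cA; apply: (kuratowski_ulam t0 s0
  (A := [set z | A (fun n => ((z n).2, (z n).1))])).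
apply: (comeager_preimage (t0, s0) (phi := fun _ p => (p.2, p.1))) cA.
by move=> _ [s t]; exists (t, s).
Qed.

(** * Small moves on sequences of natural numbers *)

Section Moves.
Implicit Types (e : bool) (h g : nat -> bool) (x : nat -> nat).

(** The orbits of [step false] are the pairs [{0,1}, {2,3}, ...] and those of
    [step true] are [{0}, {1,2}, {3,4}, ...]: each is an involution, so that
    applying it at chosen coordinates is an action of the group [nat -> bool],
    and together they connect all of [nat] in steps of length one. *)
Definition step e j := if odd j == e then j.+1 else j.-1.

Lemma stepK e : involutive (step e).
Proof.
case: e => -[|j]; rewrite /step //= ?eqbF_neg ?eqb_id.
all: by case o : (odd j); rewrite //= ?o.
Qed.

Definition move e h x : nat -> nat :=
  fun n => if h n then step e (x n) else x n.

Lemma move_comp e h g x :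
  move e (fun n => h n (+) g n) (move e g x) = move e h x.
Proof.
by apply/funext => n; rewrite /move; case: (h n) (g n) => -[] //=; rewrite stepK.
Qed.
End Moves.

(** * Isomorphisms of countable structures *)

Section Iso.
Variable J : Type.
Implicit Types (M N : J -> seq nat -> Prop).

(** A structure is given by the truth values of its atomic formulas: [M j s] says
    that the relation [j] holds of the tuple [s]. *)
Definition isomap (p : nat -> nat) M N :=
  bijective p /\ forall j s, M j s <-> N j (map p s).

Definition isom m M N := exists2 p, isomap p M N & forall i, (i < m)%N -> p i = i.

Lemma isomap_id M : isomap id M M.
Proof. by split; [exists id|move=> j s; rewrite map_id]. Qed.

Lemma isomap_comp p q M N P : isomap p M N -> isomap q N P -> isomap (q \o p) M P.
Proof.
move=> [bp pMN] [bq qNP]; split; first exact: bij_comp.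
by move=> j s; rewrite pMN qNP -map_comp.
Qed.

Lemma isomap_inv p M N : isomap p M N ->
  exists q, [/\ isomap q N M, cancel p q & cancel q p].
Proof.
move=> [[q pq qp] pMN]; exists q; split=> //; split; first by exists p.
move=> j s; rewrite pMN -map_comp (eq_map (g := id)) ?map_id//.
Qed.

Lemma isom_refl m M : isom m M M.
Proof. by exists id => //; exact: isomap_id. Qed.

Lemma isom_trans m M N P : isom m M N -> isom m N P -> isom m M P.
Proof.
move=> [p pMN pm] [q qNP qm]; exists (q \o p); first exact: isomap_comp qNP.
by move=> i im /=; rewrite pm// qm.
Qed.

(** Alternately taking the next point of [M] and of [N] yields an increasing
    sequence of finite partial isomorphisms, whose union is total on both sides. *)
Lemma back_and_forth (S : seq (nat * nat) -> Prop) M N :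
  S [::] ->
  (forall l c, S l -> exists d, S ((c, d) :: l)) ->
  (forall l d, S l -> exists c, S ((c, d) :: l)) ->
  (forall l a b a' b', S l -> (a, b) \in l -> (a', b') \in l ->
     (a == a') = (b == b')) ->
  (forall l s j, S l -> {subset s <= l} -> M j (unzip1 s) <-> N j (unzip2 s)) ->
  exists p, isomap p M N.
Proof.
move=> S0 forth back inj atom.
have /choice[nxt nxtP] (q : seq (nat * nat) * nat) : exists l, S q.1 ->
    [/\ S l, {subset q.1 <= l}, exists d, (q.2, d) \in l & exists c, (c, q.2) \in l].
  have [Sl|] := pselect (S q.1); last by exists [::].
  have [d Sd] := forth _ q.2 Sl; have [c Sc] := back _ q.2 Sd.
  exists ((c, q.2) :: (q.2, d) :: q.1) => _; split=> //.
  - by move=> z zl; rewrite !inE zl !orbT.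
  - by exists d; rewrite !inE eqxx orbT.
  - by exists c; rewrite !inE eqxx.
pose l := fix l n := if n is n'.+1 then nxt (l n', n') else [::].
have Sl n : S (l n) by elim: n => //= n IH; have [] := nxtP (l n, n) IH.
have lS n := nxtP (l n, n) (Sl n).
have lmono m n : (m <= n)%N -> {subset l m <= l n}.
  move=> /subnKC<-; elim: (n - m)%N => [|k IH]; first by rewrite addn0.
  by move=> z /IH; rewrite addnS; have [_ + _ _] := lS (m + k)%N; exact.
have /choice[p pP] a : exists b, exists n, (a, b) \in l n.
  by have [_ _ [d ad] _] := lS a; exists d, a.+1.
have /choice[q qP] b : exists a, exists n, (a, b) \in l n.
  by have [_ _ _ [c cb]] := lS b; exists c, b.+1.
have injl a b a' b' : (exists n, (a, b) \in l n) -> (exists n, (a', b') \in l n) ->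
    (a == a') = (b == b').
  move=> [m am] [n bn]; apply: (inj (l (maxn m n))) => //.
    exact: lmono (leq_maxl _ _) _ am.
  exact: lmono (leq_maxr _ _) _ bn.
exists p; split.
  exists q => [a|b]; apply/eqP.
    by rewrite (injl _ _ _ _ (qP (p a)) (pP a)).
  by rewrite -(injl _ _ _ _ (pP (q b)) (qP b)).
move=> j s.
have [n sn] : exists n, {subset [seq (a, p a) | a <- s] <= l n}.
  elim: s => [|a s [n sn]]; first by exists 0%N.
  have [m am] := pP a; exists (maxn m n) => z /=; rewrite inE => /orP[/eqP->|/sn].
    exact: lmono (leq_maxl _ _) _ am.
  exact: lmono (leq_maxr _ _) _.
have := atom _ _ j (Sl n) sn.
by rewrite /unzip1 /unzip2 -!map_comp map_id.
Qed.
End Iso.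

(** * Generic ergodicity of the small moves *)

Section Turbulence.
Variables (J : countType) (F : (nat -> nat) -> J -> seq nat -> Prop).
Hypothesis F_baire : forall j s, baire_property [set x | F x j s].
Hypothesis F_move : forall e h x, isom 0 (F x) (F (move e h x)).

(* A sequence of pairs codes a point [x] together with an element [h] of the
   acting group. *)
Let fst_ (z : nat -> nat * bool) n := (z n).1.
Let snd_ (z : nat -> nat * bool) n := (z n).2.
Let mv e z := move e (snd_ z) (fst_ z).

(** Makes [comeager_preimage] applicable to [mv e]. *)
Lemma surj_step e (t : nat) : exists p : nat * bool, (if p.2 then step e p.1 else p.1) = t.
Proof. by exists (t, false). Qed.

(** The cylinders in which one can walk: generic moves that stay in [s] leave the
    first [m] points of the structure in place. *)
Definition stable_cylinder e m s := comeager [set z : nat -> nat * bool |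
  cyl s (fst_ z) -> (forall i, (i < size s)%N -> (z i).2 = false) ->
  isom m (F (fst_ z)) (F (mv e z))].

Lemma stable_cylinder_prefix e m s t : prefix s t -> stable_cylinder e m s -> stable_cylinder e m t.
Proof.
move=> st; apply: sub_comeager => z zP /(prefix_cyl st) sz z0; apply: zP => //.
by move=> i si; apply: z0; exact: leq_trans (size_prefix st).
Qed.

(** Each pair [(x, h)] comes with an isomorphism from [F (move e h x)] to [F x],
    which sends [0, ..., m-1] to some tuple [sg].  There are countably many tuples,
    so one of them, [sg], works for a nonmeager set of pairs above [u]; this set
    is analytic, hence comeager in a product of two cylinders.  If [sg] works for
    both [(x, g)] and [(x, h)], then composing gives an isomorphism from
    [F (move e g x)] to [F (move e h x)] that fixes [0, ..., m-1].  Fix a generic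
    [g] and take [move e g x] as new base point. *)
Lemma stable_cylinder_cofinal e m : cofinal (stable_cylinder e m).
Proof.
(* h is required to vanish on the coordinates of u, so that the new base point
   still lies above u *)
move=> u; pose u0 := mkseq (fun i => (nth 0%N u i, false)) (size u).
have [C cC Ccont] := baire_property_continuous
  (A := fun a : J * seq nat => [set x | F x a.1 a.2]) (fun a => F_baire a.1 a.2).
pose Z := [set z : nat -> nat * bool | C (fst_ z) /\ C (mv e z)].
have cZ : comeager Z.
  apply: comeagerI.
    apply: (comeager_preimage (0%N, false) (phi := fun _ p => p.1)) cC.
    by move=> _ t; exists (t, false).
  apply: (comeager_preimage (0%N, false)
    (phi := fun _ p => if p.2 then step e p.1 else p.1)) cC.
  by move=> _; exact: surj_step.
(* w codes an isomorphism and its inverse *)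
pose P (sg : seq nat) (z : nat -> nat * bool) (w : nat -> nat * nat) :=
  [/\ forall i, (w (w i).1).2 = i, forall i, (w (w i).2).1 = i,
      mkseq (fun i => (w i).1) m = sg &
      forall j s, F (mv e z) j s <-> F (fst_ z) j [seq (w i).1 | i <- s]].
have Pcl sg z w : Z z -> (forall n, exists z' w',
     [/\ Z z', cyl (mkseq z n) z', cyl (mkseq w n) w' & P sg z' w']) -> P sg z w.
  move=> [Cz Cmz] H; split.
  - move=> i; have [z' [w' [_ _ /cyl_mkseq_agree ww' [+ _ _ _]]]] := H (maxn i (w i).1).+1.
    by move/(_ i); rewrite !ww'// ltnS ?leq_maxl ?leq_maxr.
  - move=> i; have [z' [w' [_ _ /cyl_mkseq_agree ww' [_ + _ _]]]] := H (maxn i (w i).2).+1.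
    by move/(_ i); rewrite !ww'// ltnS ?leq_maxl ?leq_maxr.
  - have [z' [w' [_ _ /cyl_mkseq_agree ww' [_ _ <- _]]]] := H m.
    by apply/eq_in_map => i; rewrite mem_iota => /= im; rewrite ww'.
  - move=> j s.
    have [n1 Hn1] := Ccont _ (j, s) Cmz.
    have [n2 Hn2] := Ccont _ (j, [seq (w i).1 | i <- s]) Cz.
    have [n3 Hn3] : exists n, forall i, i \in s -> (i < n)%N.
      exists (\max_(i <- s) i).+1 => i si; rewrite ltnS.
      exact: (@leq_bigmax_seq _ _ _ id).
    have [z' [w' [[Cz' Cmz'] /cyl_mkseq_agree zz' /cyl_mkseq_agree ww' [_ _ _ Pz]]]] :=
      H (maxn n1 (maxn n2 n3)).
    have E1 : F (mv e z') j s <-> F (mv e z) j s.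
      apply: Hn1 => //; apply/cyl_mkseq_agree => i in1.
      by rewrite /mv /move /snd_ /fst_ zz'// leq_max in1.
    have E2 : F (fst_ z') j [seq (w i).1 | i <- s] <->
              F (fst_ z) j [seq (w i).1 | i <- s].
      apply: Hn2 => //; apply/cyl_mkseq_agree => i in1.
      by rewrite /fst_ zz'// !leq_max in1 orbT.
    rewrite -E1 -E2 Pz.
    suff -> : [seq (w' i).1 | i <- s] = [seq (w i).1 | i <- s] by [].
    by apply/eq_in_map => i si; rewrite ww'// !leq_max Hn3// !orbT.
have Pisom sg z z' : fst_ z = fst_ z' -> (exists w, P sg z w) -> (exists w, P sg z' w) ->
    isom m (F (mv e z)) (F (mv e z')).
  move=> zz' [w [w12 w21 wm Pw]] [w' [w12' w21' wm' Pw']].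
  have i1 : isomap (fun i => (w i).1) (F (mv e z)) (F (fst_ z)).
    by split=> //; exists (fun i => (w i).2).
  have i2 : isomap (fun i => (w' i).2) (F (fst_ z)) (F (mv e z')).
    split; first by exists (fun i => (w' i).1).
    by move=> j s; rewrite Pw' -zz' -map_comp (eq_map (g := id)) ?map_id//.
  exists ((fun i => (w' i).2) \o (fun i => (w i).1)); first exact: isomap_comp i1 i2.
  move=> i im /=; have : nth 0%N sg i = nth 0%N sg i by [].
  by rewrite -{1}wm -wm' !nth_mkseq// => ->.
(* some tuple sg works on a nonmeager set, hence on a comeager subset of v *)
have [||sg ncsg] := @nonmeager_bigcup _ _
    (fun sg => [set z | exists w, P sg z w]) setT u0.
- move=> z _; have [p] := F_move e (snd_ z) (fst_ z).
  move=> /isomap_inv[q [[_ qF] pq qp]] _.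
  exists (mkseq q m) => //; exists (fun i => (q i, p i)); by split.
- rewrite setCT => /(baire (0%N, false))[z _]; exact.
have [v uv cv] := analytic_comeager (0%N, false) (0%N, 0%N) cZ (Pcl sg) ncsg.
have [g gv cg] := baire (u := [seq p.2 | p <- v]) false
  (comeager_comeager_in _ (kuratowski_ulam 0%N false cv)).
pose v1 := nth 0%N [seq p.1 | p <- v].
have nthv i : (i < size v)%N -> nth (0%N, false) v i = (v1 i, g i).
  move=> iv; rewrite /v1 (nth_map (0%N, false))//.
  have /(cyl_nth false)/(_ i) -> := gv; rewrite ?size_map//.
  by rewrite (nth_map (0%N, false))//; case: nth.
exists (mkseq (move e g v1) (size v)).
  have suv := size_prefix uv; rewrite size_mkseq in suv.
  apply: cyl_prefix_mkseq => //; apply/(cyl_nth 0%N) => i iu.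
  have := nthv _ (leq_trans iu suv); move/prefixP: uv => [w ->].
  by rewrite nth_cat size_mkseq iu nth_mkseq// /move => -[<- <-].
(* the change of base point (y, k) |-> (move e g y, k + g) *)
pose psi n (p : nat * bool) := (if g n then step e p.1 else p.1, p.2 (+) g n).
have c1 := comeager_preimage (0%N, false) (phi := fun _ p => p.1)
  (fun _ t => ex_intro _ (t, false) erefl) cg.
have psiS n t : exists s, psi n s = t.
  exists (psi n t); case: t => j b; rewrite /psi /= addbK.
  by case: (g n); rewrite ?stepK.
apply: sub_comeager (comeager_preimage (0%N, false) psiS (comeagerI c1 cv)).
move=> z [] /=; set z' := fun n => psi n (z n); set z0 := fun n => (_, g n).
move=> H0 H1 /cyl_mkseq_agree zs; rewrite size_mkseq => z20.
have fz' i : (i < size v)%N -> fst_ z' i = v1 i.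
  move=> iv; rewrite /fst_ /z' /psi /= -[(z i).1]/(fst_ z i) zs// /move.
  by case: (g i); rewrite ?stepK.
have {}H0 : exists w, P sg z0 w.
  apply: H0; apply/(cyl_nth (0%N, false)) => i iv; rewrite nthv// /z0.
  by congr (_, _); exact: fz'.
have {}H1 : exists w, P sg z' w.
  apply: H1; apply/(cyl_nth (0%N, false)) => i iv; rewrite nthv//.
  rewrite -(fz' i)// /z' /psi /fst_ /= z20 //.
have := Pisom _ _ _ _ H0 H1; rewrite /z0 => /(_ erefl).
have fE : fst_ z' = move e g (fst_ z) by [].
have -> : mv e z0 = fst_ z.
  rewrite /mv -[fst_ z0]/(fst_ z') fE -[RHS](move_comp e (fun=> false) g).
  by congr move; apply/funext => n.
suff -> : mv e z' = mv e z by [].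
by rewrite /mv fE -[RHS](move_comp e (snd_ z) g).
Qed.

Definition stable_point (C : set (nat -> nat)) x :=
  [/\ C x,
      forall e m s, stable_cylinder e m s -> cyl s x ->
        comeager [set h | (forall i, (i < size s)%N -> h i = false) ->
                          isom m (F x) (F (move e h x))] &
      forall m, exists n, forall e, stable_cylinder e m (mkseq x n)].

Lemma comeager_stable_point (C : set (nat -> nat)) : comeager C -> comeager (stable_point C).
Proof.
move=> cC.
have cG : comeager [set x | forall e m s, stable_cylinder e m s -> cyl s x ->
        comeager [set h | (forall i, (i < size s)%N -> h i = false) ->
                          isom m (F x) (F (move e h x))]].
  apply: comeager_bigcap => e; apply: comeager_bigcap => m; apply: comeager_bigcap => s.
  have [gs|] := pselect (stable_cylinder e m s); last by move=> ?; apply: comeager_setT.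
  apply: sub_comeager (kuratowski_ulam_swap 0%N false gs) => x cx _ sx.
  by apply: sub_comeager cx => h Hh; exact: Hh.
have cD : comeager [set x | forall m, exists n, forall e, stable_cylinder e m (mkseq x n)].
  apply: comeager_bigcap => m.
  apply: (comeager_meets (D := [set s | forall e, stable_cylinder e m s])) => u.
  have [v uv gv] := stable_cylinder_cofinal true m u.
  have [w vw gw] := stable_cylinder_cofinal false m v.
  exists w; first exact: prefix_trans vw.
  by case=> //; exact: stable_cylinder_prefix gv.
by apply: sub_comeager (comeagerI cC (comeagerI cG cD)) => x [? []].
Qed.

Lemma comeager_moves (C : set (nat -> nat)) e :
  comeager C -> comeager [set x | comeager [set h | C (move e h x)]].
Proof.
move=> cC; apply: (kuratowski_ulam_swap 0%N false (A := [set z | C (mv e z)])).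
apply: (comeager_preimage (0%N, false)
  (phi := fun _ p => if p.2 then step e p.1 else p.1)) cC.
by move=> _; exact: surj_step.
Qed.

(** Iterating [comeager_moves] countably often gives a comeager set that generic
    moves do not leave. *)
Lemma move_closed (C0 : set (nat -> nat)) : comeager C0 ->
  exists C, [/\ comeager C, C `<=` C0 &
    forall e x, C x -> comeager [set h | C (move e h x)]].
Proof.
move=> cC0.
pose Ck := fix Ck k := if k is k'.+1
  then [set x | Ck k' x /\ forall e, comeager [set h | Ck k' (move e h x)]] else C0.
exists [set x | forall k, Ck k x]; split.
- apply: comeager_bigcap; elim=> //= k IH; apply: comeagerI => //.
  by apply: comeager_bigcap => e; exact: comeager_moves.
- by move=> x /(_ 0%N).
- by move=> e x Cx; apply: comeager_bigcap => k; have [_] := Cx k.+1; exact.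
Qed.

Section GenericSet.
Variable C : set (nat -> nat).
Hypothesis Cgood : C `<=` stable_point setT.
Hypothesis Cmove : forall e x, C x -> comeager [set h | C (move e h x)].

Lemma move_step e m s x (k : nat -> bool) L : C x -> stable_cylinder e m s -> cyl s x ->
  (forall i, (i < size s)%N -> k i = false) -> (size s <= L)%N ->
  exists x', [/\ C x', isom m (F x) (F x') &
    forall i, (i < L)%N -> x' i = if k i then step e (x i) else x i].
Proof.
move=> Cx gs sx k0 sL; have [_ /(_ _ _ _ gs sx) Gx _] := Cgood Cx.
have [h /cyl_mkseq_agree hk [Ch /= Hh]] := baire false
  (comeager_comeager_in (mkseq k L) (comeagerI (Cmove e Cx) Gx)).
exists (move e h x); split => //.
  by apply: Hh => i is_; rewrite hk ?k0// (leq_trans is_).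
by move=> i iL; rewrite /move hk.
Qed.

(** Turbulence: inside a stable cylinder, single-coordinate steps perturbed by
    generic moves far out lead from [x] to any finite approximation [L] of [y],
    the structure changing only by isomorphisms that fix [0, ..., m-1].  The
    induction is on the distance of [x] to [y] over the first [L] coordinates. *)
Lemma move_path m s x y L : (forall e, stable_cylinder e m s) -> C x -> cyl s x -> cyl s y ->
  (size s <= L)%N ->
  exists x', [/\ C x', isom m (F x) (F x') & forall i, (i < L)%N -> x' i = y i].
Proof.
move=> gs + + sy sL; pose d x := \sum_(i < L) ((x i - y i) + (y i - x i))%N.
have [k] := ubnP (d x); elim: k x => // k IH x; rewrite ltnS => dk Cx sx.
have [xy|] := pselect (forall i, (i < L)%N -> x i = y i).
  by exists x; split=> //; exact: isom_refl.
move=> /existsNP[i /not_implyP[iL /eqP xyi]].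
have is_ : (size s <= i)%N.
  rewrite leqNgt; apply/negP => ilt; move/(cyl_nth 0%N)/(_ i ilt) : sx.
  by move/(cyl_nth 0%N)/(_ i ilt) : sy => <-; exact/eqP.
(* the involution for which step e (x i) is one closer to y i *)
pose e := if (x i < y i)%N then odd (x i) else ~~ odd (x i).
have [|x1 [Cx1 xx1 x1E]] := @move_step e m s x (pred1 i) L Cx (gs e) sx _ sL.
  by move=> j js; apply/negbTE; rewrite /= neq_ltn (leq_trans js is_).
have x1i : x1 i = if (x i < y i)%N then (x i).+1 else (x i).-1.
  by rewrite x1E//= eqxx /step /e; case: (x i < y i)%N; case: (odd (x i)).
have x1j j : (j < L)%N -> j != i -> x1 j = x j.
  by move=> jL ji; rewrite x1E//= (negbTE ji).
have [||x2 [Cx2 x12 x2y]] := IH x1 _ Cx1.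
- apply: leq_trans dk; rewrite /d (bigD1 (Ordinal iL))//= [ltnRHS](bigD1 (Ordinal iL))//=.
  rewrite -addSn; apply: leq_add.
    rewrite x1i; move/eqP: xyi => xyi; case: ifP => lt; lia.
  by apply: leq_sum => j ji; rewrite x1j//.
- apply: cyl_agree sx => j js; rewrite x1j//; first exact: leq_trans sL.
  by rewrite neq_ltn (leq_trans js is_).
exists x2; split => //; exact: isom_trans x12.
Qed.

(** The system of partial maps for the back-and-forth construction.  A finite
    partial map [l] is admissible if [F x] and [F y] can be replaced by isomorphic
    structures at points [x'] and [y'] of a common stable cylinder, so that
    the points matched by [l] become equal and are among [0, ..., m-1]. *)
Definition matched x y (l : seq (nat * nat)) := exists x' y' p q m s,
  [/\ [/\ C x', C y', cyl s x' & cyl s y'], forall e, stable_cylinder e m s,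
      isomap p (F x) (F x'), isomap q (F y) (F y') &
      forall ab, ab \in l -> p ab.1 = q ab.2 /\ (p ab.1 < m)%N].

Lemma matched_sym x y l : matched x y l -> matched y x [seq (ab.2, ab.1) | ab <- l].
Proof.
move=> [x' [y' [p [q [m [s [[? ? ? ?] ? ? ? l_]]]]]]].
exists y', x', q, p, m, s; split=> // ab /mapP[cd /l_ [pq pm] ->] /=.
by rewrite -pq.
Qed.

(** Enlarge [m] beyond the new point [p c] and choose a stable cylinder around [x']
    for the larger value; [y'] can be moved into it without disturbing the points
    that are already matched. *)
Lemma matched_forth x y l c : matched x y l -> exists d, matched x y ((c, d) :: l).
Proof.
move=> [x' [y' [p [q [m [s [[Cx' Cy' sx' sy'] gs px qy l_]]]]]]].
pose m1 := maxn m (p c).+1.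
have [_ _ /(_ m1) [n gn]] := Cgood Cx'.
pose L := maxn n (size s).
have [y1 [Cy1 [r ry rm] y1x]] := move_path gs Cy' sy' sx' (leq_maxr n (size s)).
have qr := isomap_comp qy ry; have [qr' [_ _ qrK]] := isomap_inv qr.
exists (qr' (p c)), x', y1, p, (r \o q), m1, (mkseq x' L); split=> //.
- by split=> //; [exact: cyl_mkseq|exact/cyl_mkseq_agree].
- by move=> e; apply: stable_cylinder_prefix (gn e); exact/prefix_mkseq/leq_maxl.
- move=> ab; rewrite inE => /orP[/eqP->|/l_[pq pm]] /=.
    by split; [rewrite -[RHS]/((r \o q) _) qrK|rewrite leq_max ltnSn orbT].
  by rewrite -pq rm// leq_max pm.
Qed.

End GenericSet.

(** The back-and-forth system [matched] serves for all generic [x] and [y].  Atomic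
    formulas about matched points agree: since [F] is continuous on a
    comeager set, the truth value of an atomic formula at [x'] persists nearby,
    and [y'] can be moved close to [x'] by an isomorphism fixing all the points
    in the formula. *)
Lemma generic_isomorphism : exists2 D, comeager D &
  forall x y, D x -> D y -> isom 0 (F x) (F y).
Proof.
have [C0 cC0 Ccont] := baire_property_continuous
  (A := fun a : J * seq nat => [set x | F x a.1 a.2]) (fun a => F_baire a.1 a.2).
have [C [cC CC0 Cmove]] := move_closed (comeager_stable_point cC0).
have Cgood : C `<=` stable_point setT by move=> x /CC0[].
have Catom x y l s j : matched C x y l -> {subset s <= l} ->
    F x j (unzip1 s) <-> F y j (unzip2 s).
  move=> [x' [y' [p [q [m [t [[Cx' Cy' tx' ty'] gt px qy l_]]]]]]] sl.
  have pq : map p (unzip1 s) = map q (unzip2 s).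
    by rewrite /unzip1 /unzip2 -!map_comp; apply/eq_in_map => ab /sl/l_[].
  have [C0x' _ _] := CC0 _ Cx'.
  have [n Hn] := Ccont _ (j, map p (unzip1 s)) C0x'.
  have [y1 [Cy1 [r ry rm] y1x]] := move_path Cgood Cmove gt Cy' ty' tx' (leq_maxr n (size t)).
  have [C0y1 _ _] := CC0 _ Cy1.
  rewrite px.2 qy.2 ry.2 -pq.
  have -> : map r (map p (unzip1 s)) = map p (unzip1 s).
    rewrite -map_comp; apply/eq_in_map => a /mapP[ab /sl/l_[_ ?] ->].
    exact: rm.
  apply: iff_sym; apply: Hn => //; apply/cyl_mkseq_agree => i iln.
  by apply: y1x; rewrite leq_max iln.
exists C => // x y Cx Cy.
suff [p px] : exists p, isomap p (F x) (F y) by exists p.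
apply: (back_and_forth (S := matched C x y)).
- have g0 e : stable_cylinder e 0 [::] by apply: comeager_setT => z _ _; exact: F_move.
  exists x, y, id, id, 0%N, [::]; split=> //; exact: isomap_id.
- by move=> l c; exact: matched_forth.
- move=> l d /matched_sym/matched_forth-/(_ Cgood Cmove d)[c /matched_sym /=].
  rewrite -map_comp (eq_map (g := id)) ?map_id; last by case.
  by exists c.
- move=> l a b a' b' [x' [y' [p [q [m [t [_ _ [bp _] [bq _] l_]]]]]]].
  move=> /l_[/= + _] => ab /l_[/= + _] => ab'.
  by rewrite -(inj_eq (bij_inj bp)) ab ab' (inj_eq (bij_inj bq)).
- by move=> l s j; exact: Catom.
Qed.
End Turbulence.

(** * Measure-theoretic preliminaries *)

Lemma measure_bigcup_le d (T : measurableType d) (R : realType)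
    (mu : {measure set T -> \bar R}) (F : (set T)^nat) (c : \bar R) :
  (forall n, measurable (F n)) -> nondecreasing_seq F ->
  (forall n, mu (F n) <= c)%E -> (mu (\bigcup_n F n) <= c)%E.
Proof.
move=> mF ndF Fc.
have cvgF : mu \o F @ \oo --> mu (\bigcup_n F n).
  by apply: nondecreasing_cvg_mu => //; exact: bigcupT_measurable.
rewrite -(cvg_lim _ cvgF)//; apply: lime_le; first by apply/cvg_ex; eexists; exact: cvgF.
exact: nearW.
Qed.

Lemma measure_bigcap_ge d (T : measurableType d) (R : realType)
    (mu : {finite_measure set T -> \bar R}) (F : (set T)^nat) (c : \bar R) :
  (forall n, measurable (F n)) -> nonincreasing_seq F ->
  (forall n, c <= mu (F n))%E -> (c <= mu (\bigcap_n F n))%E.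
Proof.
move=> mF niF Fc.
have cvgF : mu \o F @ \oo --> mu (\bigcap_n F n).
  apply: nonincreasing_cvg_mu => //; last exact: bigcapT_measurable.
  by rewrite -ge0_fin_numE// fin_num_measure.
rewrite -(cvg_lim _ cvgF)//; apply: lime_ge; first by apply/cvg_ex; eexists; exact: cvgF.
exact: nearW.
Qed.

Lemma countable_bigcup_measurable d (T : measurableType d) (I : countType)
    (P : set I) (F : I -> set T) :
  (forall i, P i -> measurable (F i)) -> measurable (\bigcup_(i in P) F i).
Proof.
move=> mF; rewrite bigcup_mkcond; apply: countable_bigcupT_measurable => // i.
by case: ifPn => [/set_mem/mF|].
Qed.

Lemma measurable_preimage_cyl d (Y : measurableType d) (c : Y -> nat -> bool) u :
  (forall n, measurable [set y | c y n]) -> measurable (c @^-1` cyl u).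
Proof.
move=> mc; have -> : c @^-1` cyl u = \bigcap_(i in `I_(size u))
    (if nth false u i then [set y | c y i] else ~` [set y | c y i]).
  apply/seteqP; split=> y.
    by move=> /(cyl_nth false) uy i /= /uy <-; case cy : (c y i); rewrite /= cy.
  move=> uy; apply/(cyl_nth false) => i /uy.
  by case: (nth _ _ _) => //= /negP/negbTE.
by apply: bigcap_measurableType => i _; case: ifP => _ //; exact: measurableC.
Qed.

Section RealMeasure.
Context (R : realType) (d : measure_display)
  (X : measurableType d) (mu : probability X R).
Implicit Types A B : set X.

Let m A : R := fine (mu A).

Lemma fine_muK A : measurable A -> (m A)%:E = mu A.
Proof. by move=> mA; rewrite fineK// fin_num_measure. Qed.

Lemma fine_mu_le A B : measurable A -> measurable B -> A `<=` B -> m A <= m B.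
Proof.
by move=> mA mB AB; rewrite -lee_fin !fine_muK// le_measure// inE.
Qed.

Lemma fine_muU A B : measurable A -> measurable B -> m (A `|` B) <= m A + m B.
Proof.
move=> mA mB; rewrite -lee_fin EFinD !fine_muK//; last exact: measurableU.
exact: measureU2.
Qed.

Lemma fine_muC A : measurable A -> m (~` A) = 1 - m A.
Proof.
move=> mA; apply: EFin_inj; rewrite EFinB !fine_muK//; last exact: measurableC.
by rewrite probability_setC.
Qed.

Lemma fine_mu0 : m set0 = 0. Proof. by rewrite /m measure0. Qed.

Lemma fine_mu_bigcup (F : (set X)^nat) N : (forall n, measurable (F n)) ->
  m (\bigcup_(i in `I_N) F i) <= \sum_(i < N) m (F i).
Proof.
move=> mF; elim: N => [|N IH]; first by rewrite II0 bigcup_set0 big_ord0 fine_mu0.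
rewrite big_ord_recr/= IIS bigcup_setU bigcup_set1; apply: le_trans (fine_muU _ _) _ => //.
  by apply: bigcup_measurable.
by rewrite lerD2r.
Qed.
End RealMeasure.

(** * Chains of almost invariant sets *)

Section Chains.
Context (G : groupType) (R : realType) (d : measure_display)
  (X : measurableType d) (mu : probability X R) (a : pmp_action G mu).

Let m A : R := fine (mu A).

Lemma act_image g A : a g @` A = a g^-1%g @^-1` A.
Proof.
rewrite eqEsubset; split => [_ [x Ax <-]|x Ax] /=.
  by rewrite -actM mulVg act1.
by exists (a g^-1%g x) => //; rewrite -actM mulgV act1.
Qed.

Lemma act_preimage_measurable g A : measurable A -> measurable (a g @^-1` A).
Proof. by move=> mA; rewrite -[X in measurable X]setTI; exact: measurable_act. Qed.

Lemma measurable_defect g A : measurable A -> measurable (A `+` a g @^-1` A).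
Proof.
move=> mA; have ma := act_preimage_measurable g mA.
by apply: measurableU; exact: measurableD.
Qed.

(** Almost invariance expressed by preimages and real numbers; since [g] ranges over
    a group, preimages and images are interchangeable. *)
Definition asymptotically_invariant (A : (set X)^nat) :=
  (forall n, measurable (A n)) /\
  forall g e, 0 < e -> exists N, forall n, (N <= n)%N -> m (A n `+` a g @^-1` A n) < e.

Lemma almost_invariantW A : almost_invariant a A -> asymptotically_invariant A.
Proof.
move=> [mA cA]; split=> // g e e0; have := cA g^-1%g.
under eq_fun do rewrite act_image invgK.
move=> /fine_cvgP[_ /cvgr0Pnorm_lt/(_ e e0)[N _ HN]].
exists N => n Nn; apply: le_lt_trans (HN n Nn); exact: ler_norm.
Qed.

(** If [mu A * (1 - mu A)] does not tend to 0, it is at least some [e > 0] infinitely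
    often, and then [mu A] and [1 - mu A], which are at most 1, are at least [e]. *)
Lemma nontrivial_sequence :
  ergodic a -> ~ strongly_ergodic a ->
  exists2 A, asymptotically_invariant A &
    exists2 e : R, 0 < e & forall n, e <= m (A n) <= 1 - e.
Proof.
move=> erg nse.
have [A [aA ntA]] : exists A, almost_invariant a A /\ ~ trivial_sequence mu A.
  apply: contrapT => H; apply: nse; split=> // A aA; apply: contrapT => ntA.
  by apply: H; exists A.
have [mA iA] := almost_invariantW aA.
have muE n : (mu (A n) * (1 - mu (A n)))%E = (m (A n) * (1 - m (A n)))%:E.
  by rewrite EFinM EFinB fine_muK.
have [e e0 He] : exists2 e : R, 0 < e & forall N, exists n, (N <= n)%N /\
    e <= m (A n) * (1 - m (A n)).
  apply: contrapT => H; apply: ntA; rewrite /trivial_sequence.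
  under eq_fun do rewrite muE.
  apply: cvg_EFin; first by apply: nearW.
  apply/cvgr0Pnorm_lt => e e0.
  apply: contrapT => He; apply: H; exists e => // N.
  apply: contrapT => HN; apply: He; exists N => // n /= Nn.
  rewrite ltNge; apply/negP => en; apply: HN; exists n; split=> //.
  have m1 : m (A n) <= 1 by rewrite -lee_fin fine_muK// probability_le1.
  have m0 : 0 <= m (A n) by rewrite fine_ge0.
  by rewrite ger0_norm// in en; apply: mulr_ge0 => //; rewrite subr_ge0.
have /choice[phi Hphi] := He.
exists (A \o phi).
  split=> [n|g r r0] /=; first exact: mA.
  have [N HN] := iA g r r0; exists N => n Nn; apply: HN.
  by apply: leq_trans Nn _; have [] := Hphi n.
exists e => // n /=; have [_] := Hphi n.
have m1 : m (A (phi n)) <= 1 by rewrite -lee_fin fine_muK// probability_le1.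
have m0 : 0 <= m (A (phi n)) by rewrite fine_ge0.
by move: (m _) m1 m0 => t; nra.
Qed.

Hypothesis countG : countable [set: G].
Hypothesis erg : ergodic a.

Lemma group_enumeration : exists gam : nat -> G, forall g, exists n, gam n = g.
Proof.
have /countable_injP[f finj] := countG.
exists (fun n => xget 1%g [set g | f g = n]) => g; exists (f g).
have := xgetI 1%g (erefl (f g) : [set h | f h = f g] g).
by move=> /finj; apply; rewrite inE.
Qed.

Lemma saturation_conull (gam : nat -> G) D : (forall g, exists n, gam n = g) ->
  measurable D -> mu D != 0%E -> mu (\bigcup_n a (gam n) @^-1` D) = 1%E.
Proof.
move=> gamS mD D0; set U := \bigcup_n _.
have mU : measurable U by apply: bigcupT_measurable => n; exact: act_preimage_measurable.
have [g||//] := erg mU.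
  rewrite act_image eqEsubset; split=> x [n _] /= Dx.
    by have [k kE] := gamS (gam n * g^-1)%g; exists k => //=; rewrite kE actM.
  have [k kE] := gamS (gam n * g)%g; exists k => //=.
  by rewrite kE -actM -mulgA mulgV mulg1.
move=> U0; exfalso; move/negP: D0; apply; apply/eqP/(subset_measure0 _ mU _ U0) => //.
by move=> x Dx; have [k kE] := gamS 1%g; exists k => //=; rewrite kE act1.
Qed.

(** If [mu D > 0], finitely many translates of [D] cover all but [e / 2] of the
    space.  For those [n] where [A n] avoids [D], the set [A n] nearly avoids each
    translate as well, by almost invariance, so its measure is less than [e]. *)
Lemma null_of_avoiding A D e : asymptotically_invariant A -> 0 < e ->
  (forall n, e <= m (A n)) -> measurable D ->
  (forall N, exists n, (N <= n)%N /\ A n `&` D = set0) -> mu D = 0%E.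
Proof.
move=> [mA iA] e0 eA mD AD; apply/eqP; apply: contrapT => /negP D0.
have [gam gamS] := group_enumeration.
pose F N := \bigcup_(i in `I_N) a (gam i) @^-1` D.
have mF N : measurable (F N).
  by apply: bigcup_measurable => i _; exact: act_preimage_measurable.
have [N FN] : exists N, 1 - e / 2 < m (F N).
  apply: contrapT => H.
  have FU : \bigcup_N F N = \bigcup_n a (gam n) @^-1` D.
    rewrite eqEsubset; split=> x [n _]; first by move=> [i _ Dx]; exists i.
    by move=> Dx; exists n.+1 => //; exists n => /=.
  have : (mu (\bigcup_N F N) <= (1 - e / 2)%:E)%E.
    apply: measure_bigcup_le => //.
      move=> i j ij; apply/subsetPset => x [k /= ki Dx].
      by exists k => //=; exact: leq_trans ij.
    move=> N; rewrite -[leLHS](fine_muK mu (mF N)) lee_fin leNgt; apply/negP => FN.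
    by apply: H; exists N.
  rewrite FU saturation_conull// lee_fin; lra.
(* N errors of size r add up to less than e / 2 *)
pose r := e / (2 * N.+1%:R).
have r0 : 0 < r by rewrite divr_gt0// mulr_gt0.
have /choice[M HM] i : exists M, forall n, (M <= n)%N ->
   m (A n `+` a (gam i) @^-1` A n) < r by exact: iA.
have [n [Mn AnD]] := AD (\max_(i < N) M i).
have mdef i := measurable_defect (gam i) (mA n).
have : m (A n) <= m (~` F N) + \sum_(i < N) m (A n `+` a (gam i) @^-1` A n).
  apply: (@le_trans _ _ (m (~` F N `|` \bigcup_(i in `I_N) (A n `+` a (gam i) @^-1` A n)))).
    apply: fine_mu_le => //.
      by apply: measurableU; [exact: measurableC|exact: bigcup_measurable].
    move=> x Ax; have [[i iN Dx]|] := pselect (F N x); last by left.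
    right; exists i => //; left; split=> // Agx.
    by have : (A n `&` D) (a (gam i) x) by []; rewrite AnD.
  apply: le_trans (fine_muU _ _ _) _; first exact: measurableC.
    exact: bigcup_measurable.
  by rewrite lerD2l; exact: fine_mu_bigcup.
rewrite -[m (~` _)]/(fine _) fine_muC// -/(m (F N)) => H.
have : \sum_(i < N) m (A n `+` a (gam i) @^-1` A n) <= \sum_(i < N) r.
  apply: ler_sum => i _; apply/ltW/HM; apply: leq_trans Mn.
  exact: (leq_bigmax i).
rewrite sumr_const card_ord -mulr_natr => H1.
have : r * N%:R <= e / 2.
  rewrite /r invfM mulrA -mulrA ler_piMr//; first by rewrite divr_ge0// ltW.
  by rewrite mulrC ler_pdivrMr// mul1r ler_nat.
by have := eA n; lra.
Qed.

Lemma asymptotically_invariantC A :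
  asymptotically_invariant A -> asymptotically_invariant (fun n => ~` A n).
Proof.
move=> [mA iA]; split=> [n|g e e0]; first exact: measurableC.
have [N HN] := iA g e e0; exists N => n /HN.
suff -> : ~` A n `+` a g @^-1` (~` A n) = A n `+` a g @^-1` A n by [].
rewrite /setY preimage_setC !setDE !setCK setUC.
by congr (_ `|` _); rewrite setIC.
Qed.

(** Either [A n] or its complement avoids [D] infinitely often. *)
Lemma null_of_trapped A D e : asymptotically_invariant A -> 0 < e ->
  (forall n, e <= m (A n) <= 1 - e) -> measurable D ->
  (forall n, D `<=` A n \/ A n `&` D = set0) -> mu D = 0%E.
Proof.
move=> iA e0 eA mD DA; have mA := iA.1.
have [H|] := pselect (forall N, exists n, (N <= n)%N /\ A n `&` D = set0).
  by apply: null_of_avoiding iA e0 _ mD H => n; have /andP[] := eA n.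
move=> /existsNP[N HN].
apply: null_of_avoiding (asymptotically_invariantC iA) e0 _ mD _ => n.
  by rewrite /m fine_muC// -/(m _); have := eA n; lra.
exists (maxn n N); split; first exact: leq_maxl.
have [DAn|H] := DA (maxn n N); first by rewrite setIC -setDE setD_eq0.
by exfalso; apply: HN; exists (maxn n N); rewrite leq_maxr.
Qed.

Section Itinerary.
Variable A : (set X)^nat.
Hypothesis mA : forall n, measurable (A n).

Definition itinerary (x : X) (n : nat) := `[< A n x >].

Lemma measurable_cyl u : measurable (itinerary @^-1` cyl u).
Proof.
apply: measurable_preimage_cyl => n; rewrite (_ : [set x | _] = A n)//.
by apply/seteqP; split=> x /asboolP.
Qed.

Lemma measurable_itinerary (P : seq bool -> Prop) k :
  measurable [set x | P (mkseq (itinerary x) k)].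
Proof.
have -> : [set x | P (mkseq (itinerary x) k)] =
    \bigcup_(u in [set u : seq bool | P u /\ size u = k]) itinerary @^-1` cyl u.
  rewrite eqEsubset; split=> x.
    by move=> Px; exists (mkseq (itinerary x) k); rewrite /= /cyl /= ?size_mkseq.
  by move=> [u [Pu <-]] /= ->.
by apply: countable_bigcup_measurable => u _; exact: measurable_cyl.
Qed.
End Itinerary.

(** Koenig's lemma: if atoms of measure at least [eps] existed at all depths, then
    they would exist along a whole branch, whose intersection [D] would have
    measure at least [eps].  But no [A n] splits [D], so [D] is null. *)
Lemma itinerary_thin A e eps : asymptotically_invariant A -> 0 < e ->
  (forall n, e <= m (A n) <= 1 - e) -> 0 < eps ->
  exists k, forall u, size u = k -> m (itinerary A @^-1` cyl u) < eps.
Proof.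
move=> iA e0 eA eps0; apply: contrapT => H; have mA := iA.1.
pose At u := itinerary A @^-1` cyl u.
have mAt u : measurable (At u) by exact: measurable_cyl.
have Atle u v : prefix u v -> m (At v) <= m (At u).
  by move=> uv; apply: fine_mu_le => // x; exact: prefix_cyl.
have big k : exists2 u, size u = k & eps <= m (At u).
  apply: contrapT => Hk; apply: H; exists k => u uk.
  by rewrite ltNge; apply/negP => ?; apply: Hk; exists u.
(* T u: arbitrarily deep atoms inside the one of u are large *)
pose T u := forall k, exists v, [/\ prefix u v, (k <= size v)%N & eps <= m (At v)].
have T0 : T [::] by move=> k; have [u <- ?] := big k; exists u; split=> //; exact: prefix0s.
have TS u : T u -> exists b, T (rcons u b).
  move=> Tu; apply: contrapT => /forallNP nT.
  have /existsNP[k1 H1] := nT true; have /existsNP[k2 H2] := nT false.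
  have [v [/prefixP[[|b w] ->]]] := Tu (maxn (size u).+1 (maxn k1 k2)).
    by rewrite cats0 geq_max ltnn.
  rewrite -cat_rcons !geq_max => /and3P[_ vk1 vk2] ev.
  have ub : prefix (rcons u b) (rcons u b ++ w) by exact: prefix_prefix.
  by case: b ub vk1 vk2 ev => ub vk1 vk2 ev;
    [apply: H1; exists (rcons u true ++ w)|apply: H2; exists (rcons u false ++ w)].
have /choice[nxt nxtP] (u : seq bool) : exists b, T u -> T (rcons u b).
  by have [/TS[b Tb]|nT] := pselect (T u); [exists b|exists true].
pose s := fix s n := if n is n'.+1 then rcons (s n') (nxt (s n')) else [::].
have Ts n : T (s n) by elim: n => //= n; exact: nxtP.
pose w n := nxt (s n).
have sw n : s n = mkseq w n by elim: n => //= n IH; rewrite mkseqS -IH.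
pose D := \bigcap_n At (s n).
have mD : measurable D by apply: bigcapT_measurable.
have epsD : (eps%:E <= mu D)%E.
  apply: measure_bigcap_ge => // [i j ij|n].
    by apply/subsetPset => x; apply: prefix_cyl; rewrite !sw; exact: prefix_mkseq.
  have [v [sv _ ev]] := Ts n 0%N.
  by rewrite -[leRHS](fine_muK mu (mAt _)) lee_fin (le_trans ev)// Atle.
have := null_of_trapped iA e0 eA mD.
suff DA n : D `<=` A n \/ A n `&` D = set0.
  by move=> /(_ DA) D0; move: epsD; rewrite D0 lee_fin leNgt eps0.
have Dw x : D x -> itinerary A x n = w n.
  by move=> /(_ n.+1 I); rewrite sw => /cyl_mkseq_agree; exact.
case wn : (w n); [left|right].
  by move=> x /Dw; rewrite wn => /asboolP.
by apply/seteqP; split=> // x [Ax /Dw]; rewrite wn => /asboolP.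
Qed.

(** Pass to a subsequence of [A] whose invariance errors have sum less than [eps],
    and choose the depth [k] after that, with atoms of measure less than [eps].
    All sets in the algebra generated by the first [k] sets then have invariance
    error at most [eps], whatever [k] is, and this applies to the unions [B j] of
    initial segments of atoms in a fixed enumeration. *)
Lemma invariant_chain (K : seq G) eps A e : asymptotically_invariant A -> 0 < e ->
  (forall n, e <= m (A n) <= 1 - e) -> 0 < eps ->
  exists (B : nat -> set X) (M : nat),
  [/\ forall j, measurable (B j), B 0%N = set0, forall j, (M <= j)%N -> B j = setT,
      forall j, m (B j `+` B j.+1) <= eps &
      forall g j, g \in K -> m (B j `+` a g @^-1` B j) <= eps].
Proof.
move=> [mA iA] e0 eA eps0.
have /choice[phi Hphi] i : exists n, (i <= n)%N /\
    forall g, g \in K -> m (A n `+` a g @^-1` A n) <= eps / 2 ^+ i.+1.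
  have epsi : 0 < eps / 2 ^+ i.+1 by rewrite divr_gt0// exprn_gt0.
  have /choice[N HN] g := iA g _ epsi.
  exists (maxn i (\max_(g <- K) N g)); split; first exact: leq_maxl.
  move=> g gK; apply/ltW/HN/(leq_trans _ (leq_maxr _ _)).
  exact: (@leq_bigmax_seq _ _ _ N).
pose A' := A \o phi.
have iA' : asymptotically_invariant A'.
  split=> [n|g r r0] /=; first exact: mA.
  have [N HN] := iA g r r0; exists N => n Nn; apply: HN.
  by apply: leq_trans Nn _; have [] := Hphi n.
have mA' := iA'.1.
have [k Hk] := itinerary_thin iA' e0 (fun n => eA (phi n)) eps0.
pose c x := mkseq (itinerary A' x) k.
pose B j := [set x | (pickle (c x) < j)%N].
have mB j : measurable (B j) by exact: (measurable_itinerary mA' (fun u => (pickle u < j)%N)).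
exists B, (\max_(t : k.-tuple bool) pickle (tval t)).+1; split=> //.
- by apply/seteqP; split=> // x; rewrite /B /= ltn0.
- move=> j Mj; apply/seteqP; split=> // x _; rewrite /B /=.
  have sc : size (c x) == k by rewrite size_mkseq.
  apply: leq_ltn_trans Mj.
  exact: (leq_bigmax (F := fun t : k.-tuple bool => pickle (tval t)) (Tuple sc)).
- move=> j; have BB : B j `+` B j.+1 = [set x | pickle (c x) = j].
    apply/seteqP; split=> x; rewrite /B /setY /=.
      by case=> -[]; [move=> jx []; exact: ltnW|rewrite ltnS leq_eqVlt => /orP[/eqP|]].
    by move=> ->; right; split; rewrite ?ltnn.
  rewrite BB.
  case uj : (@unpickle (seq bool) j) => [u|]; last first.
    have -> : [set x | pickle (c x) = j] = set0.
      by apply/seteqP; split=> // x /= xj; move: uj; rewrite -xj pickleK.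
    by rewrite /m fine_mu0 ltW.
  have sub : [set x | pickle (c x) = j] `<=` itinerary A' @^-1` cyl u.
    by move=> x /= xj; move: uj; rewrite -xj pickleK => -[<-]; exact: cyl_mkseq.
  have mcyl := measurable_cyl mA' u.
  have [uk|uk] := eqVneq (size u) k.
    apply: le_trans (ltW (Hk u uk)); apply: fine_mu_le => //.
    exact: (measurable_itinerary mA' (fun u => pickle u = j)).
  have -> : [set x | pickle (c x) = j] = set0; last by rewrite /m fine_mu0 ltW.
  apply/seteqP; split=> // x /= xj; move: uj; rewrite -xj pickleK => -[cu].
  by move/eqP: uk; rewrite -cu size_mkseq.
- move=> g j gK.
  apply: (@le_trans _ _ (m (\bigcup_(i in `I_k) (A' i `+` a g @^-1` A' i)))).
    apply: fine_mu_le; first exact: measurable_defect.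
      by apply: bigcup_measurable => i _; exact: measurable_defect.
    move=> x Bx; apply: contrapT => nx.
    suff cE : c x = c (a g x) by move: Bx; rewrite /B /setY /= cE; case=> -[].
    apply/eq_in_map => i; rewrite mem_iota /= => ik.
    apply: contrapT => ne; apply: nx; exists i => //.
    move: ne; rewrite /itinerary /setY /=.
    by case: asboolP => ?; case: asboolP => ? // _; [left|right].
  apply: le_trans (fine_mu_bigcup _ _ _) _; first by move=> i; exact: measurable_defect.
  apply: (@le_trans _ _ (\sum_(i < k) eps / 2 ^+ i.+1)).
    by apply: ler_sum => i _; exact: (Hphi i).2.
  have -> : \sum_(i < k) eps / 2 ^+ i.+1 = eps - eps / 2 ^+ k.
    elim: k {Hk c B mB} => [|k IH]; first by rewrite big_ord0 expr0 divr1 subrr.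
    rewrite big_ord_recr/= IH exprS; field.
    by rewrite expf_neq0.
  by rewrite gerBl divr_ge0// ?exprn_ge0// ltW.
Qed.
End Chains.

(** * Measurability and the Cantor space *)

(** Borel-Cantelli, for errors that are summable from the rank [N] on. *)
Lemma ae_eventually_not d (X : measurableType d) (R : realType)
    (mu : {measure set X -> \bar R}) (F : (set X)^nat) N :
  (forall n, measurable (F n)) ->
  (forall n, (N <= n)%N -> mu (F n) <= (1 / 2 ^+ n.+1)%:E)%E ->
  {ae mu, forall w, exists k, forall n, (k <= n)%N -> ~ F n w}.
Proof.
move=> mF Fle.
have : mu (lim_sup_set (fun n => F (n + N)%N)) = 0%E.
  apply: lim_sup_set_cvg0 => //.
  apply: (@le_lt_trans _ _ 1%E); last exact: ltry.
  apply: le_trans (epsilon_trick0 xpredT ler01).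
  apply: lee_nneseries => [//|n _]; apply: le_trans (Fle _ (leq_addl _ _)) _.
  rewrite lee_fin natrX !div1r lef_pV2 ?posrE ?exprn_gt0//.
  by rewrite ler_weXn2l ?ler1n// ltnS leq_addr.
have mlim : measurable (lim_sup_set (fun n => F (n + N)%N)).
  apply: bigcapT_measurable => k; apply: bigcup_measurable => j _; exact: mF.
move=> lim0; exists (lim_sup_set (fun n => F (n + N)%N)); split=> // w nw k _.
apply: contrapT => H; apply: nw; exists (k + N)%N => n kn Fn; apply: H.
exists (n - N)%N; first by rewrite /= leq_subRL ?(leq_trans (leq_addl k N))// addnC.
by rewrite subnK// (leq_trans (leq_addl k N)).
Qed.

(** Otherwise some points outside [O] that agree with [c] on longer and longer
    initial segments would converge to [c]. *)
Lemma cantor_open_cyl (O : set cantor_space) c : open O -> O c ->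
  exists n, forall c' : cantor_space, cyl (mkseq c n) c' -> O c'.
Proof.
move=> oO Oc; apply: contrapT => /forallNP H.
have /choice[s Hs] n : exists c' : cantor_space, cyl (mkseq c n) c' /\ ~ O c'.
  by have /existsNP[c' /not_implyP] := H n; exists c'.
have sc : {ptws, s @ \oo --> (c : nat -> bool)}.
  apply/pointwise_cvgP => i A /nbhs_singleton Aci.
  exists i.+1 => // n /= ltin; have /cyl_mkseq_agree/(_ i ltin) := (Hs n).1.
  by move=> ->.
have /(sc _)[n _ /(_ n (leqnn n))] : nbhs c O by exact: open_nbhs_nbhs.
exact: (Hs n).2.
Qed.

Lemma measurable_to_cantor d (Y : measurableType d) (f : Y -> borel cantor_space) :
  (forall n, measurable [set y | f y n = true]) -> measurable_fun setT f.
Proof.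
move=> mf; have sG : @measurable _ (borel cantor_space) = <<s @open cantor_space>> by [].
apply: (@measurability _ _ Y (borel cantor_space) setT f _ sG).
move=> _ [U oU <-]; rewrite setTI.
have -> : f @^-1` U = \bigcup_(u in [set u | cyl u `<=` U]) f @^-1` cyl u.
  apply/seteqP; split=> y /=; last by move=> [u uU]; exact: uU.
  move=> /(cantor_open_cyl oU)[n Hn]; exists (mkseq (f y) n) => //.
  exact: cyl_mkseq.
by apply: countable_bigcup_measurable => u _; exact: measurable_preimage_cyl.
Qed.

(** Taking all sets with the property of Baire as measurable sets lets the
    measurability theory of products and integrals deliver this property. *)
Definition baire_space := g_sigma_algebraType (@baire_property nat).

Lemma measurable_baire_property (A : set baire_space) :
  measurable A -> baire_property A.
Proof.
apply: smallest_sub => //; split.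
- by move=> u; exists u; [exact: prefix_refl|right; by apply: comeager_setT => x _ []].
- by move=> B /baire_property_setC; rewrite setTD.
- by move=> F; exact: baire_property_bigcup.
Qed.

Lemma measurable_baire_coord n j : measurable ([set x | x n = j] : set baire_space).
Proof.
apply: sub_sigma_algebra => u.
exists (u ++ nseq n.+1 0%N); first exact: prefix_prefix.
set v := u ++ _.
have nv : (n < size v)%N by rewrite size_cat size_nseq addnS ltnS leq_addl.
have [vj|vj] := eqVneq (nth 0%N v n) j; [left|right]; apply: comeager_setT => x.
  by move=> /(cyl_nth 0%N)/(_ n nv)/= ->.
by move=> /(cyl_nth 0%N)/(_ n nv)/= ->; exact/eqP.
Qed.

Lemma eval_continuous (I : eqType) (J : I -> eqType) (V : topologicalType) i t :
  continuous (fun f : prod_topology (fun i => {ptws J i -> V}) => f i t).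
Proof.
move=> f; apply: (@continuous_comp _ _ _
    (fun f : prod_topology (fun i => {ptws J i -> V}) => f i)
    (fun f : {ptws J i -> V} => f t)); first exact: proj_continuous.
exact: (@proj_continuous _ (fun=> V)).
Qed.

(** * Countable structures as relational structures *)

Section Structures.
Variable L : signature.
Implicit Types M N : countable_structure L.

(** Function symbols are replaced by their graphs, so that all structures become
    relational. *)
Definition diagram M (r : Defs.fsym L + Defs.rsym L) (s : seq nat) : Prop :=
  match r with
  | inl i => exists t : (farity i).-tuple nat, s = rcons t (M.1 i t)
  | inr j => exists2 t : (rarity j).-tuple nat, s = t & M.2 j t
  end.

Lemma structure_isoP M N : structure_iso M N <-> isom 0 (diagram M) (diagram N).
Proof.
split=> [[g [bg gf gr]]|[p [bp pMN] _]].
  have dia (g' : nat -> nat) M' N' : (forall i t, g' (M'.1 i t) = N'.1 i [tuple of map g' t]) ->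
      (forall j t, M'.2 j t = N'.2 j [tuple of map g' t]) ->
      forall r s, diagram M' r s -> diagram N' r (map g' s).
    move=> g'f g'r [i|j] s /= [t ->]; first by exists [tuple of map g' t]; rewrite map_rcons g'f.
    by rewrite g'r => Nt; exists [tuple of map g' t].
  have [h gh hg] := bg.
  have tupK n (t : n.-tuple nat) : [tuple of map g [tuple of map h t]] = t.
    by apply: val_inj; rewrite /= -map_comp (eq_map (g := id)) ?map_id.
  exists g => //; split=> // r s; split; first exact: dia.
  move=> /(dia h N M); rewrite -map_comp (eq_map (g := id)) ?map_id; last exact: gh.
  apply => [i t|j t]; last by rewrite gr tupK.
  by rewrite -{1}(tupK _ t) -gf gh.
exists p; split=> // [i t|j t].
  have /pMN[t'] : diagram M (inl i) (rcons t (M.1 i t)) by exists t.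
  rewrite map_rcons => /rcons_inj[tt' ->]; congr (N.1 i _).
  by apply: val_inj; rewrite /= tt'.
apply/idP/idP => [Mt|Nt].
  have /pMN[t' tt'] : diagram M (inr j) t by exists t.
  by suff -> : [tuple of map p t] = t' by []; exact: val_inj.
have /pMN[t' tt'] : diagram N (inr j) (map p t) by exists [tuple of map p t].
by suff -> : t = t' by []; exact: val_inj.
Qed.

Lemma measurable_diagram r s :
  measurable ([set M | diagram M r s] : set (borel (countable_structure L))).
Proof.
have mev1 i t k : measurable ([set M | M.1 i t = k] : set (borel (countable_structure L))).
  apply: sub_sigma_algebra.
  have /continuousP/(_ [set k]) : continuous (fun M : countable_structure L => M.1 i t).
    move=> M; apply: (@continuous_comp (countable_structure L) _ _ fst
      (fun f : prod_topology
        (fun i : Defs.fsym L => {ptws (farity i).-tuple nat -> nat}) => f i t)).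
      exact: cvg_fst.
    exact: (@eval_continuous _ (fun i => (farity i).-tuple nat) nat).
  by apply; exact: discrete_open.
have mev2 i t k : measurable ([set M | M.2 i t = k] : set (borel (countable_structure L))).
  apply: sub_sigma_algebra.
  have /continuousP/(_ [set k]) : continuous (fun M : countable_structure L => M.2 i t).
    move=> M; apply: (@continuous_comp (countable_structure L) _ _ snd
      (fun f : prod_topology
        (fun i : Defs.rsym L => {ptws (rarity i).-tuple nat -> bool}) => f i t)).
      exact: cvg_snd.
    exact: (@eval_continuous _ (fun i => (rarity i).-tuple nat) bool).
  by apply; exact: discrete_open.
case: r => [i|j].
  rewrite (_ : [set M | _] =
    \bigcup_(t in [set t : (farity i).-tuple nat | exists k, s = rcons t k])
    [set M | s = rcons t (M.1 i t)]); last first.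
    apply/seteqP; split=> M /=; first by move=> [t ->]; exists t => //; exists (M.1 i t).
    by move=> [t _ /= st]; exists t.
  apply: countable_bigcup_measurable => t [k ->].
  rewrite (_ : [set M | _] = [set M : countable_structure L | M.1 i t = k]); first exact: mev1.
  apply/seteqP; split=> M /=; first by move=> /rcons_inj[].
  by move=> ->.
rewrite (_ : [set M | _] = \bigcup_(t in [set t : (rarity j).-tuple nat | s = t])
  [set M | M.2 j t = true]); last first.
  by apply/seteqP; split=> M /= [t]; exists t.
by apply: countable_bigcup_measurable => t _; exact: mev2.
Qed.
End Structures.

Lemma measure_ae_eq d (X : measurableType d) (R : realType)
    (mu : {measure set X -> \bar R}) (U V : set X) :
  measurable U -> measurable V -> {ae mu, forall w, U w <-> V w} -> mu U = mu V.
Proof.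
move=> mU mV [N [mN N0 UVN]].
have {}N0 : mu N = 0%E := N0.
suff le A B : measurable A -> measurable B -> A `<=` B `|` N -> (mu A <= mu B)%E.
  apply/eqP; rewrite eq_le !le// => w Aw; apply: contrapT => /not_orP[nB nN];
  by apply: nN; apply: UVN => -[UV VU]; apply: nB; auto.
move=> mA mB AB; apply: (@le_trans _ _ (mu (B `|` N))).
  by apply: le_measure => //; rewrite inE//; exact: measurableU.
have : (mu (B `|` N) <= mu B + mu N)%E by exact: measureU2.
by rewrite N0 adde0.
Qed.

(** * The homomorphisms attached to a family of chains *)

Section Reduction.
Context (G : groupType) (R : realType) (d : measure_display)
  (X : measurableType d) (mu : probability X R) (a : pmp_action G mu).
Variables (gam : nat -> G) (B : nat -> nat -> set X) (M : nat -> nat).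
Hypothesis gamS : forall g, exists n, gam n = g.
Hypothesis mB : forall n j, measurable (B n j).
Hypothesis B0 : forall n, B n 0%N = set0.
Hypothesis BM : forall n j, (M n <= j)%N -> B n j = setT.
Hypothesis Bstep : forall n j, fine (mu (B n j `+` B n j.+1)) <= 1 / 2 ^+ n.+1.
Hypothesis Binv : forall n j k, (k < n)%N ->
  fine (mu (B n j `+` a (gam k) @^-1` B n j)) <= 1 / 2 ^+ n.+1.

Definition chain_code (x : nat -> nat) (w : X) : borel cantor_space :=
  fun n => `[< B n (x n) w >].

Lemma measurable_chain_code : measurable_fun setT
  (fun p : baire_space * X => chain_code p.1 p.2).
Proof.
apply: measurable_to_cantor => n.
rewrite (_ : [set p | _] = \bigcup_j ([set x : baire_space | x n = j] `*` B n j)).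
  by apply: bigcupT_measurable => j; apply: measurableX => //; exact: measurable_baire_coord.
apply/seteqP; split=> -[x w] /=; first by move=> /asboolP Bw; exists (x n).
by move=> [j _ [/= <- Bw]]; exact/asboolP.
Qed.

Lemma measurable_chain_code_x x : measurable_fun setT (chain_code x).
Proof.
apply: measurable_to_cantor => n.
rewrite (_ : [set w | _] = B n (x n)) //.
by apply/seteqP; split=> w /asboolP.
Qed.

Definition chain_mfun x : {mfun X >-> borel cantor_space} :=
  mfun_Sub (mem_set (measurable_chain_code_x x)).

Definition chain_class x : {mfun_ mu, X >-> borel cantor_space} :=
  (\pi_({mfun_ mu, X >-> borel cantor_space})%qT (chain_mfun x)).

Lemma chain_class_ae x : {ae mu, forall w, chain_class x w = chain_code x w}.
Proof.
have /asboolP : ae_eq_op mu (repr (chain_class x)) (chain_mfun x).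
  by apply/eqmodP; rewrite reprK.
by apply: filterS => w; exact.
Qed.

(* the sets F n have to contain the points where the n-th digits differ *)
Let E0_of_ae (y z : X -> borel cantor_space) (F : (set X)^nat) N :
  (forall n, measurable (F n)) ->
  (forall n, (N <= n)%N -> fine (mu (F n)) <= 1 / 2 ^+ n.+1) ->
  (forall n w, ~ F n w -> y w n = z w n) ->
  {ae mu, forall w, E0 (y w) (z w)}.
Proof.
move=> mF Fle yz.
have : {ae mu, forall w, exists k, forall n, (k <= n)%N -> ~ F n w}.
  apply: (@ae_eventually_not _ _ _ _ _ N) => // n Nn.
  by rewrite -[leLHS](fine_muK mu (mF n)) lee_fin Fle.
by apply: filterS => w [k Hk]; exists k => n kn; apply: yz; exact: Hk.
Qed.

Lemma chain_code_act x k : {ae mu, forall w, E0 (chain_code x w) (chain_code x (a (gam k) w))}.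
Proof.
apply: (E0_of_ae (F := fun n => B n (x n) `+` a (gam k) @^-1` B n (x n)) (N := k.+1)).
- by move=> n; exact: measurable_defect.
- by move=> n kn; exact: Binv.
- move=> n w nw; rewrite /chain_code; move: nw; rewrite /setY /=.
  by case: asboolP => ?; case: asboolP => ? // []; [left|right].
Qed.

Lemma chain_code_move e h x : {ae mu, forall w, E0 (chain_code x w) (chain_code (move e h x) w)}.
Proof.
apply: (E0_of_ae (F := fun n => B n (x n) `+` B n (move e h x n)) (N := 0%N)).
- by move=> n; apply: measurableU; exact: measurableD.
- move=> n _; rewrite /move; case: (h n); last first.
    by rewrite setYK measure0 divr_ge0// exprn_ge0.
  rewrite /step; case: ifP => _; first exact: Bstep.
  case: (x n) => [|j] /=; first by rewrite setYK measure0 divr_ge0// exprn_ge0.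
  by rewrite setYC.
- move=> n w nw; rewrite /chain_code; move: nw; rewrite /setY /=.
  by case: asboolP => ?; case: asboolP => ? // []; [left|right].
Qed.

Lemma chain_hom_set x : hom_set (orbit_rel a) E0 (chain_class x).
Proof.
exists [set w | chain_class x w = chain_code x w /\
    forall k, E0 (chain_code x w) (chain_code x (a (gam k) w))].
  have act_ae : {ae mu, forall w, forall k, E0 (chain_code x w) (chain_code x (a (gam k) w))}.
    by apply: ae_foralln => k; exact: chain_code_act.
  exact: (filterS2 _ _ (chain_class_ae x) act_ae).
move=> w w' [-> Hw] [-> _] [g <-].
by have [k <-] := gamS g; exact: Hw.
Qed.

Definition chain_hom x : hom_E0_borel mu (orbit_rel a) :=
  SigSub (mem_set (chain_hom_set x)).

Lemma chain_hom_equiv x y : hom_equiv (chain_hom x) (chain_hom y) <->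
  {ae mu, forall w, E0 (chain_code x w) (chain_code y w)}.
Proof.
by split; apply: filterS3 (chain_class_ae x) (chain_class_ae y) => w /= -> ->.
Qed.

(** For [A] and [C] measurable, [mu (A `&` chain_class x @^-1` C)] is the measure of
    the section at [x] of a measurable subset of [baire_space * X], and therefore
    a measurable function of [x]. *)
Lemma measurable_chain_hom :
  measurable_fun setT (chain_hom : baire_space -> hom_E0_borel mu (orbit_rel a)).
Proof.
have mc : measurable_fun setT (chain_class : baire_space -> borel_maps (borel cantor_space) mu).
  have sG : @measurable _ (borel_maps (borel cantor_space) mu) =
    <<s @borel_map_generators _ _ _ _ _ mu >> by [].
  apply: (@measurability _ _ baire_space _ setT _ _ sG).
  move=> _ [W [A [C [mA mC [D mD <-]]]] <-]; rewrite !setTI.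
  pose S := [set p : baire_space * X | A p.2 /\ C (chain_code p.1 p.2)].
  have mS : measurable S.
    apply: measurableI.
      by rewrite -[X in measurable X]setTI; exact: measurable_snd.
    by rewrite -[X in measurable X]setTI; exact: measurable_chain_code.
  have := measurable_fun_xsection mu mS measurableT mD.
  rewrite setTI; congr (measurable _); apply/seteqP.
  have E x : mu (xsection S x) = mu (A `&` chain_class x @^-1` C).
    apply: measure_ae_eq.
    - exact: measurable_xsection.
    - apply: measurableI => //; rewrite -[X in measurable X]setTI.
      exact: (measurable_funPT (repr (chain_class x))).
    - apply: filterS (chain_class_ae x) => w /= ->.
      by rewrite /xsection /= inE.
  by split=> x /=; rewrite E.
move=> _ _ [W mW <-].
rewrite setTI.
have := mc measurableT W mW.
by rewrite !setTI.
Qed.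
End Reduction.

(** * Nonclassifiability *)

Theorem theorem3 (G : groupType) (R : realType) (d : measure_display)
    (X : measurableType d) (mu : probability X R) (a : pmp_action G mu) :
  countable [set: G] ->
  standard_borel R X ->
  ergodic a ->
  ~ strongly_ergodic a ->
  ~ classifiable_by_countable_structures
      (fun phi psi : hom_E0_borel mu (orbit_rel a) => hom_equiv phi psi).
Proof.
move=> countG _ erg nse [L [f mf fP]].
have [gam gamS] := group_enumeration countG.
have [A iA [e e0 eA]] := nontrivial_sequence erg nse.
have /choice[BM HBM] n : exists BM : (nat -> set X) * nat,
    [/\ forall j, measurable (BM.1 j), BM.1 0%N = set0,
        forall j, (BM.2 <= j)%N -> BM.1 j = setT,
        forall j, fine (mu (BM.1 j `+` BM.1 j.+1)) <= 1 / 2 ^+ n.+1 &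
        forall g j, g \in mkseq gam n ->
          fine (mu (BM.1 j `+` a g @^-1` BM.1 j)) <= 1 / 2 ^+ n.+1].
  have eps0 : 0 < 1 / 2 ^+ n.+1 :> R by rewrite divr_gt0// exprn_gt0.
  have [B [M HB]] := invariant_chain countG erg (mkseq gam n) iA e0 eA eps0.
  by exists (B, M).
pose B n := (BM n).1; pose M n := (BM n).2.
have mB n j : measurable (B n j) by have [+ _ _ _ _] := HBM n; exact.
have B0 n : B n 0%N = set0 by have [] := HBM n.
have BT n j : (M n <= j)%N -> B n j = setT by have [_ _ + _ _] := HBM n; exact.
have Bstep n j : fine (mu (B n j `+` B n j.+1)) <= 1 / 2 ^+ n.+1.
  by have [_ _ _ + _] := HBM n; exact.
have Binv n j k : (k < n)%N ->
    fine (mu (B n j `+` a (gam k) @^-1` B n j)) <= 1 / 2 ^+ n.+1.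
  by move=> kn; have [_ _ _ _] := HBM n; apply; apply: map_f; rewrite mem_iota.
pose th := chain_hom gamS mB Binv.
have mth : measurable_fun setT (th : baire_space -> hom_E0_borel mu (orbit_rel a)) :=
  measurable_chain_hom gamS mB Binv.
pose F x := diagram (f (th x)).
have Fbaire r s : baire_property [set x | F x r s].
  apply: measurable_baire_property.
  have := measurableT_comp mf mth measurableT (measurable_diagram r s).
  by rewrite setTI.
have Fmove e' h x : isom 0 (F x) (F (move e' h x)).
  apply/structure_isoP/fP/chain_hom_equiv; exact: chain_code_move.
have [D cD DF] := generic_isomorphism Fbaire Fmove.
have [|x _ [Dx x0]] := @baire _ 0%N [::]
    (D `&` [set x | forall N, exists n, (N <= n)%N /\ x n = 0%N]).
  apply/comeager_comeager_in/comeagerI => //.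
  apply: (comeager_often 0%N (P := fun n j => j = 0%N)) => N.
  by exists N; split=> //; exists 0%N.
have [|y _ [Dy yM]] := @baire _ 0%N [::] (D `&` [set y | forall N, exists n, (N <= n)%N /\
    (x n = 0%N /\ (M n <= y n)%N)]).
  apply/comeager_comeager_in/comeagerI => //.
  apply: (comeager_often 0%N (P := fun n j => x n = 0%N /\ (M n <= j)%N)) => N.
  by have [n [Nn xn]] := x0 N; exists n; split=> //; exists (M n).
(* the codes of x and y differ at every point w, which would make X null *)
have /structure_isoP/fP/chain_hom_equiv[Z [mZ Z0 nZ]] := DF x y Dx Dy.
have ZT : Z = setT.
  apply/seteqP; split=> // w _; apply: nZ => -[N HN].
  have [n [Nn [xn0 yn]]] := yM N; have := HN n Nn.
  rewrite /chain_code xn0 B0 (BT _ _ yn) => BE.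
  have : `[< [set: X] w >] by exact/asboolP.
  by rewrite -BE => /asboolP.
move: Z0; rewrite ZT probability_setT => /eqP.
by rewrite eqe oner_eq0.
Qed.
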